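(* Let $\Omega=\Omega_1\times\cdots\times\Omega_N$ with each $\Omega_k$ finite or countably infinite, and let $\mu$ be a probability measure on $\Omega$. Suppose that $\mu$ satisfies the ergodicity assumption $$\lim_{t\to\infty}\mathrm{Ent}_\mu(f_t)=0,\qquad f_t=e^{t\mathcal L}f,$$ for every bounded measurable function $f:\Omega\to[0,\infty)$, where $(e^{t\mathcal L})_{t\ge0}$ is the heat bath semigroup of $\mu$. Let $\alpha_{i,k},\delta_{i,k}$ ($i\ne k$) be the coefficients of $\mu$ defined in the context, and assume that $\gamma+\kappa<1$, where $$\gamma=\max_i\sum_{k:\,k\ne i}|\alpha_{i,k}\alpha_{k,i}-1|,\qquad \kappa=\frac14\max_i\sum_{k:\,k\ne i}(\delta_{k,i}+\delta_{i,k})\,\alpha_{i,k}\alpha_{k,i}.$$ Then for every bounded measurable function $f:\Omega\to[0,\infty)$ $$\mathrm{Ent}_\mu(f)\le C\sum_{k=1}^N\mu\big[\mathrm{Ent}_{\mu_k}(f)\big],\qquad C=(1-\gamma-\kappa)^{-1}.$$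
   Context: Notation: $\mu[f]$ is the expectation of $f$ under $\mu$, and $\mathrm{Ent}_\mu(f)=\mu[f\log f]-\mu[f]\log\mu[f]$ for bounded $f\ge0$. For $x\in\Omega$, $\bar x_k=(x_j)_{j\neq k}$ and $\bar x_{i,k}=\bar x_{k,i}=(x_j)_{j\ne i,\,j\neq k}$, with $\bar\Omega_{i,k}=\prod_{j\ne i,\,j\neq k}\Omega_j$. The conditional probability on $\Omega_k$ is $$\mu_k^{\bar x_k}(x_k)=\mu(x_k\mid\bar x_k)=\frac{\mu(x_k,\bar x_k)}{\sum_{y_k\in\Omega_k}\mu(y_k,\bar x_k)},$$ and $\mu_k[g]$ is the function $\mu_k[g](x)=\sum_{y_k\in\Omega_k}\mu_k^{\bar x_k}(y_k)g(y_k,\bar x_k)$. $\mathrm{Ent}_{\mu_k}(f)$ denotes the function $\mu_k[f\log f]-\mu_k[f]\log\mu_k[f]$. Heat bath semigroup: $(e^{t\mathcal L})_{t\ge0}$ is the Markov semigroup with generator $\mathcal Lf=\sum_{k=1}^N(\mu_k[f]-f)$. Coefficients: for $i\ne k$, writing $\mu_k^{x_i,\bar x_{i,k}}$ for $\mu_k^{\bar x_k}$ with $\bar x_k=(x_i,\bar x_{i,k})$, $$\phi_{i,k}(x_i,y_i,x_k,\bar x_{i,k})=\frac{\mu_k^{x_i,\bar x_{i,k}}(x_k)}{\mu_k^{y_i,\bar x_{i,k}}(x_k)},$$ $$\alpha_{i,k}=\sup_{x_i,y_i\in\Omega_i,\,x_k\in\Omega_k,\,\bar x_{i,k}\in\bar\Omega_{i,k}}\phi_{i,k}(x_i,y_i,x_k,\bar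 x_{i,k}),$$ $$\delta_{i,k}=\sup_{x_i,y_i\in\Omega_i,\,x_k,y_k\in\Omega_k,\,\bar x_{i,k}\in\bar\Omega_{i,k}}\big|\phi_{i,k}(x_i,y_i,x_k,\bar x_{i,k})-\phi_{i,k}(x_i,y_i,y_k,\bar x_{i,k})\big|.$$ *)

(* Defs.v *)
From HB Require Import structures.
From mathcomp Require Import all_boot all_order all_algebra.
From mathcomp Require Import all_classical all_reals all_analysis.

Set Implicit Arguments.
Unset Strict Implicit.
Unset Printing Implicit Defensive.

Import Order.TTheory GRing.Theory Num.Theory.
Import numFieldNormedType.Exports.

Local Open Scope classical_set_scope.
Local Open Scope ring_scope.

(* The product space Omega_1 x ... x Omega_N, with the sigma-algebra of all
   its subsets.  The base points provided by [pointedType] only record that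
   the factors are nonempty, which the existence of a probability measure on
   the product forces anyway. *)
Definition config (N : nat) (Omega : 'I_N -> pointedType) : Type :=
  forall k, Omega k.

HB.instance Definition _ (N : nat) (Omega : 'I_N -> pointedType) :=
  Pointed.copy (config Omega) (forall k, Omega k).

HB.instance Definition _ (N : nat) (Omega : 'I_N -> pointedType) :=
  @isMeasurable.Build default_measure_display (config Omega)
    discrete_measurable discrete_measurable0
    discrete_measurableC discrete_measurableU.

(* Sum of an absolutely summable real family. *)
Definition rsum (R : realType) (T : choiceType) (a : T -> R) : R :=
  fine (\esum_(t in [set: T]) (a^\+ t)%:E) -
  fine (\esum_(t in [set: T]) (a^\- t)%:E).

Section HeatBath.
Context {R : realType} {N : nat} {Omega : 'I_N -> pointedType}.
Variable mu : probability (config Omega) R.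
Implicit Types (x : config Omega) (f g : config Omega -> R) (i k : 'I_N).

Definition Ent f : R :=
  \int[mu]_x (f x * ln (f x)) - (\int[mu]_x f x) * ln (\int[mu]_x f x).

(* (y, \bar x_k).  A conditional law given \bar x_k takes the whole of [x] as
   an argument below, but depends on it only through \bar x_k. *)
Definition upd x k (y : Omega k) : config Omega := dfwith x k y.

Definition marginal k x : \bar R :=
  \esum_(y in [set: Omega k]) mu [set upd x y].

(* \mu_k^{\bar x_k}(y).  When the marginal of \bar x_k vanishes this is 0; such
   [x] are mu-null, and the heat bath started from a point of positive mass
   only visits points of positive mass. *)
Definition condp k x (y : Omega k) : R :=
  fine (mu [set upd x y]) / fine (marginal k x).

Definition condE k g : config Omega -> R :=
  fun x => rsum (fun y : Omega k => condp x y * g (upd x y)).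

Definition condEnt k f : config Omega -> R :=
  fun x => condE k (fun z => f z * ln (f z)) x -
           condE k f x * ln (condE k f x).

Definition heat_bath_generator f : config Omega -> R :=
  fun x => \sum_(k < N) (condE k f x - f x).

(* e^{tL} f as the exponential series: L is bounded for the sup norm. *)
Definition heat_bath (t : R) f : config Omega -> R :=
  fun x => limn (series (fun n =>
    exp_coeff t n * iter n heat_bath_generator f x)).

(* \phi_{i,k}(x_i, y_i, x_k, \bar x_{i,k}), where [x] supplies x_i and
   \bar x_{i,k} (its k-th coordinate is irrelevant).  The quotient of
   extended reals is +oo if only the denominator vanishes. *)
Definition phi i k x (yi : Omega i) (xk : Omega k) : \bar R :=
  ((condp x xk)%:E / (condp (upd x yi) xk)%:E)%E.

(* The points where the quotient [phi] makes sense: both conditional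
   probabilities are defined, and it is not 0 / 0.  This holds everywhere
   when mu charges every point. *)
Definition phi_dom i k x (yi : Omega i) (xk : Omega k) : Prop :=
  [/\ (0 < marginal k x)%E, (0 < marginal k (upd x yi))%E &
      0 < condp x xk \/ 0 < condp (upd x yi) xk].

Definition alpha i k : \bar R :=
  ereal_sup [set r | exists x (yi : Omega i) (xk : Omega k),
    phi_dom x yi xk /\ r = phi x yi xk].

Definition delta i k : \bar R :=
  ereal_sup [set r | exists x (yi : Omega i) (xk yk : Omega k),
    [/\ phi_dom x yi xk, phi_dom x yi yk &
        r = `|phi x yi xk - phi x yi yk|%E]].

(* All summands are nonnegative, so 0 is a neutral default for the maxima.
   If some alpha is +oo then so is gamma, since every alpha is at least 1
   (take y_i = x_i). *)
Definition gamma : \bar R :=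
  (\big[maxe/0]_(i < N) \sum_(k < N | k != i) `|alpha i k * alpha k i - 1|)%E.

Definition kappa : \bar R :=
  ((4^-1)%:E * \big[maxe/0]_(i < N)
     \sum_(k < N | k != i) (delta k i + delta i k) * (alpha i k * alpha k i))%E.

End HeatBath.

(* Main.v *)
Require Import Defs.
From HB Require Import structures.
From mathcomp Require Import all_boot all_order all_algebra.
From mathcomp Require Import all_classical all_reals all_analysis.
From mathcomp Require Import ring lra.

Set Implicit Arguments.
Unset Strict Implicit.
Unset Printing Implicit Defensive.

Import Order.TTheory GRing.Theory Num.Theory.
Import numFieldNormedType.Exports.

Local Open Scope classical_set_scope.
Local Open Scope ring_scope.

(** Let [Phi g = \sum_k mu[Ent_k g] - (1 - gamma - kappa) Ent g].  Along the heat
    bath flow [Phi] is nonincreasing, and by ergodicity its limit is nonnegative,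
    so [Phi f >= 0], which is the claim.

    Monotonicity: with [D_i = mu[(g - mu_i g) ln g]], the off-diagonal part of the
    derivative of [\sum_k mu[Ent_k g]] is a sum over [i != k] of
    [mu[(g - mu_i g) ln mu_k g] - D_i].  For fixed remaining coordinates, the
    increment of [mu_k g] between [x_i] and [x'_i] splits into a mean increment of
    [g] and a covariance of [g] with [phi_{i,k}].  Comparing both with the
    logarithmic mean of the two values of [mu_k g] bounds the expectation by
    [(alpha_{i,k} alpha_{k,i} + delta_{i,k} / 4) D_i
      + delta_{i,k} alpha_{i,k} alpha_{k,i} / 4 D_k].

    The flow is approximated by the explicit Euler scheme [(1 + t L / n)^n], which
    preserves positivity; each step increases [Phi] by at most [O(n^-2)], so that
    no derivative has to be exchanged with a sum. *)

(** * Absolutely summable families *)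

(** The factor 1/4 in [kappa] is a product of two halves. Centring the density [q' / q] at the
    midpoint of its range bounds the covariance by half the oscillation [d]. The resulting bound on
    [A * Cov], namely [d / 2] times a geometric mean of two dissipations, is turned into their sum
    by AM-GM, which gives the other half. That sum charges both D_i and D_k, hence the symmetrised
    [delta k i + delta i k]. The factors [alpha] enter by homogeneity: the logarithmic mean is
    monotone and 1-homogeneous, so bounds U <= c F' and V <= c F on two averages pass to the
    logarithmic means with the same c. Only updates that increase mu_k g have to be treated, because
    the heat bath is reversible. Two obstacles shape the rest. Logarithms of g require g bounded
    away from 0, so the flow starts from f + 1/(n+1) and the shift is removed at the end.
    Conditional laws given a null configuration default to the zero measure, so most bounds and
    identities are stated at points of positive mass. *)

Section Rsum.
Context {R : realType}.
Implicit Types T : choiceType.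

Definition asummable T (a : T -> R) := summable [set: T] (EFin \o a).

Lemma asummable_le T (a b : T -> R) :
  (forall t, `|a t| <= `|b t|) -> asummable b -> asummable a.
Proof.
move=> ab; apply: le_lt_trans; apply: le_esum => t _ /=.
by rewrite lee_fin.
Qed.

Lemma asummableD T (a b : T -> R) :
  asummable a -> asummable b -> asummable (fun t => a t + b t).
Proof. by move=> sa sb; have := summableD sa sb. Qed.

(** Only domination and additivity are at hand, so the scalar is replaced by a natural number above
    [|c|], that is, by a repeated sum. *)
Lemma asummableZ T (c : R) (a : T -> R) :
  asummable a -> asummable (fun t => c * a t).
Proof.
move=> sa; pose n := (Num.truncn `|c|).+1.
have sn k : asummable (fun t => a t *+ k).
  elim: k => [|k ih]; first by rewrite /asummable /summable esum1// => t _ /=; rewrite mulr0n normr0.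
  by apply: asummable_le (asummableD sa ih) => t /=; rewrite mulrS.
apply: asummable_le (sn n) => t.
rewrite normrM normrMn -mulr_natl ler_wpM2r//.
by rewrite ltW// truncnS_gt.
Qed.

Lemma asummableN T (a : T -> R) : asummable a -> asummable (fun t => - a t).
Proof. by apply: asummable_le => t; rewrite normrN. Qed.

Lemma asummableB T (a b : T -> R) :
  asummable a -> asummable b -> asummable (fun t => a t - b t).
Proof. by move=> sa sb; apply: asummableD => //; apply: asummableN. Qed.

Lemma asummable_fin T (a : T -> R) : (forall t, 0 <= a t) -> asummable a ->
  (\esum_(t in [set: T]) (a t)%:E)%E \is a fin_num.
Proof.
move=> a0 sa; rewrite ge0_fin_numE; last by apply: esum_ge0 => t _; rewrite lee_fin.
by apply: le_lt_trans sa; apply: le_esum => t _ /=; rewrite lee_fin ler_norm.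
Qed.

(** From [a^+ - a^- = u - v] follows [a^+ + v = a^- + u], an identity between nonnegative families,
    on which extended sums are additive. Linearity of [rsum] rests on this freedom in the choice of
    a decomposition. *)
Lemma rsum_diff T (u v : T -> R) :
  (forall t, 0 <= u t) -> (forall t, 0 <= v t) -> asummable u -> asummable v ->
  rsum (fun t => u t - v t) =
  fine (\esum_(t in [set: T]) (u t)%:E) - fine (\esum_(t in [set: T]) (v t)%:E).
Proof.
move=> u0 v0 su sv; rewrite /rsum.
set a := (fun t => u t - v t).
have sa : asummable a by exact: asummableB.
have p0 t : 0 <= a^\+ t by rewrite /funrpos le_max lexx orbT.
have n0 t : 0 <= a^\- t by rewrite /funrneg le_max lexx orbT.
have sp : asummable a^\+.
  by apply: asummable_le sa => t; rewrite ger0_norm// /funrpos ge_max normr_ge0 ler_norm.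
have sn : asummable a^\-.
  by apply: asummable_le sa => t; rewrite ger0_norm// /funrneg ge_max normr_ge0 -normrN ler_norm.
have e : (\esum_(t in [set: T]) (a^\+ t)%:E + \esum_(t in [set: T]) (v t)%:E =
   \esum_(t in [set: T]) (a^\- t)%:E + \esum_(t in [set: T]) (u t)%:E)%E.
  rewrite -!esumD; try by move=> t _; rewrite lee_fin.
  apply: eq_esum => t _; rewrite -!EFinD; congr (_%:E).
  rewrite /funrpos /funrneg /a.
  by have [h|h] := leP (u t - v t) 0; [rewrite max_l|rewrite max_r]; lra.
have := congr1 fine e; rewrite !fineD ?asummable_fin//.
set x := fine _; lra.
Qed.

Lemma rsum_ge0E T (u : T -> R) : (forall t, 0 <= u t) -> asummable u ->
  rsum u = fine (\esum_(t in [set: T]) (u t)%:E).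
Proof.
move=> u0 su.
have s0 : asummable (fun _ : T => 0 : R) by apply: asummable_le su => t; rewrite normr0.
rewrite -[in LHS](_ : (fun t => u t - 0) = u); last by apply/funext => t; rewrite subr0.
by rewrite rsum_diff// [X in _ - fine X]esum1// subr0.
Qed.

Lemma asummable_dec T (a : T -> R) : asummable a ->
  exists u v, [/\ (forall t, 0 <= u t), (forall t, 0 <= v t), asummable u, asummable v &
    forall t, a t = u t - v t].
Proof.
move=> sa; exists (fun t => `|a t| + a t), (fun t => `|a t|); split => //.
- by move=> t; rewrite -lerBlDr sub0r -normrN ler_norm.
- by apply: asummableD => //; apply: asummable_le sa => t; rewrite normr_id.
- by apply: asummable_le sa => t; rewrite normr_id.
- by move=> t; lra.
Qed.

Lemma eq_rsum T (a b : T -> R) : a =1 b -> rsum a = rsum b.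
Proof. by move=> /funext ->. Qed.

Lemma rsum0 T : rsum (fun _ : T => 0 : R) = 0.
Proof.
rewrite rsum_ge0E//; first by rewrite esum1.
by rewrite /asummable /summable esum1// => t _ /=; rewrite normr0.
Qed.

Lemma rsumD T (a b : T -> R) : asummable a -> asummable b ->
  rsum (fun t => a t + b t) = rsum a + rsum b.
Proof.
move=> /asummable_dec[u [v [u0 v0 su sv /funext ea]]].
move=> /asummable_dec[w [z [w0 z0 sw sz /funext eb]]].
have -> : rsum (fun t => a t + b t) = rsum (fun t => (u t + w t) - (v t + z t)).
  by apply: eq_rsum => t; rewrite ea eb; lra.
rewrite ea eb !rsum_diff//; last 4 first.
- by move=> t; rewrite addr_ge0.
- by move=> t; rewrite addr_ge0.
- exact: asummableD.
- exact: asummableD.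
under [in LHS]eq_esum do rewrite EFinD.
under [X in _ - fine X = _]eq_esum do rewrite EFinD.
rewrite !esumD; try by move=> t _; rewrite lee_fin.
by rewrite !fineD ?asummable_fin//; lra.
Qed.

Lemma rsumN T (a : T -> R) : asummable a -> rsum (fun t => - a t) = - rsum a.
Proof.
move=> sa; have := rsumD sa (asummableN sa).
by under eq_rsum do rewrite subrr; rewrite rsum0; lra.
Qed.

Lemma rsumB T (a b : T -> R) : asummable a -> asummable b ->
  rsum (fun t => a t - b t) = rsum a - rsum b.
Proof. by move=> sa sb; rewrite rsumD ?rsumN//; exact: asummableN. Qed.

(** The negative part vanishes, and [fine] sends an infinite positive part to 0, so divergent
    families are covered as well. *)
Lemma rsum_ge0 T (a : T -> R) : (forall t, 0 <= a t) -> 0 <= rsum a.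
Proof.
move=> a0; rewrite /rsum (_ : \esum_(t in _) (a^\- t)%:E = 0)%E ?subr0.
  by apply: fine_ge0; apply: esum_ge0 => t _; rewrite lee_fin /funrpos le_max lexx orbT.
apply: esum1 => t _; rewrite /funrneg; congr (_%:E); apply/eqP.
by rewrite eq_le ge_max lexx andbT le_max lexx orbT oppr_le0 a0.
Qed.

Lemma le_rsum T (a b : T -> R) : asummable a -> asummable b ->
  (forall t, a t <= b t) -> rsum a <= rsum b.
Proof.
by move=> sa sb ab; rewrite -subr_ge0 -rsumB// rsum_ge0// => t; rewrite subr_ge0.
Qed.

Lemma ler_term_rsum T (a : T -> R) t : (forall t, 0 <= a t) -> asummable a -> a t <= rsum a.
Proof.
move=> a0 sa; rewrite rsum_ge0E// -lee_fin fineK ?asummable_fin//.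
rewrite -[leLHS](@esum_set1 _ _ t (EFin \o a)) ?lee_fin//=.
rewrite [leLHS]esum_mkcond; apply: le_esum => s _ /=.
by case: ifP; rewrite ?lee_fin.
Qed.


Lemma esumZ T (c : R) (u : T -> R) : 0 <= c -> (forall t, 0 <= u t) ->
  (\esum_(t in [set: T]) (c * u t)%:E = c%:E * \esum_(t in [set: T]) (u t)%:E)%E.
Proof.
move=> c0 u0; rewrite /esum -ereal_supZl//; last first.
  by apply/set0P; exists 0%E; exists set0; [exact: fsets_set0|rewrite fsbig_set0].
congr ereal_sup; rewrite image_comp; apply/eq_imagel => A [fA _] /=.
by rewrite ge0_mule_fsumr// => t; rewrite lee_fin.
Qed.

Lemma rsumZ T (c : R) (a : T -> R) : asummable a ->
  rsum (fun t => c * a t) = c * rsum a.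
Proof.
have pos d (u : T -> R) : 0 <= d -> (forall t, 0 <= u t) -> asummable u ->
    rsum (fun t => d * u t) = d * rsum u.
  move=> d0 u0 su; rewrite !rsum_ge0E//; first by rewrite esumZ// fineM// asummable_fin.
  - by move=> t; rewrite mulr_ge0.
  - exact: asummableZ.
have gen d : 0 <= d -> asummable a -> rsum (fun t => d * a t) = d * rsum a.
  move=> d0 /asummable_dec[u [v [u0 v0 su sv /funext ->]]].
  under eq_rsum do rewrite mulrBr.
  by rewrite !rsumB ?pos ?mulrBr//; exact: asummableZ.
move=> sa; have [c0|c0] := leP 0 c; first exact: gen.
rewrite -[c]opprK; under eq_rsum do rewrite mulNr.
by rewrite rsumN ?gen ?mulNr// ?oppr_ge0 ?ltW//; exact: asummableZ.
Qed.

Lemma reindex_rsum (T T' : choiceType) (e : T -> T') (a : T' -> R) :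
  bijective e -> rsum a = rsum (fun t => a (e t)).
Proof.
move=> be; have sb : set_bij [set: T] [set: T'] e by rewrite setTT_bijective.
rewrite /rsum (@reindex_esum _ _ _ _ _ e _ sb); congr (_ - fine _).
by rewrite (@reindex_esum _ _ _ _ _ e _ sb).
Qed.

Lemma asummable_reindex (T T' : choiceType) (e : T -> T') (a : T' -> R) :
  bijective e -> asummable a -> asummable (fun t => a (e t)).
Proof.
move=> be; have sb : set_bij [set: T] [set: T'] e by rewrite setTT_bijective.
by rewrite /asummable /summable (@reindex_esum _ _ _ _ _ e _ sb).
Qed.

(** Fubini. Nonnegative families reduce to iterated extended sums; a signed one is the difference of
    [|a| + a] and [|a|], both as summable as [a]. *)
Lemma asummable_rsum (T1 T2 : choiceType) (a : T1 -> T2 -> R) :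
  asummable (fun p => a p.1 p.2) -> asummable (fun t => rsum (a t)) /\
  (forall t, asummable (a t)) /\ rsum (fun t => rsum (a t)) = rsum (fun p => a p.1 p.2).
Proof.
have pos (u : T1 -> T2 -> R) : (forall t s, 0 <= u t s) ->
    asummable (fun p => u p.1 p.2) -> [/\ asummable (fun t => rsum (u t)),
     (forall t, asummable (u t)) & rsum (fun t => rsum (u t)) = rsum (fun p => u p.1 p.2)].
  move=> u0 su.
  have e : (\esum_(t in [set: T1]) \esum_(s in [set: T2]) (u t s)%:E =
      \esum_(p in [set: T1 * T2]) (u p.1 p.2)%:E)%E.
    rewrite esum_esum//; last by move=> t s _ _; rewrite lee_fin.
    by congr esum; apply/seteqP; split.
  have lt : (\esum_(p in [set: T1 * T2]) (u p.1 p.2)%:E < +oo)%E.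
    by rewrite -ge0_fin_numE ?asummable_fin// esum_ge0// => p _; rewrite lee_fin.
  have st t : asummable (u t).
    rewrite /asummable /summable; apply: le_lt_trans lt; rewrite -e.
    apply: le_trans (esum_ge _); last first.
      exists [set t]; first by split => //; exact: finite_set1.
      by rewrite fsbig_set1.
    by apply: le_esum => s _ /=; rewrite ger0_norm.
  have ue t : (rsum (u t))%:E = (\esum_(s in [set: T2]) (u t s)%:E)%E.
    by rewrite rsum_ge0E// fineK ?asummable_fin.
  have r0 t : 0 <= rsum (u t) by exact: rsum_ge0.
  have sr : asummable (fun t => rsum (u t)).
    rewrite /asummable /summable; apply: le_lt_trans lt; rewrite -e.
    by apply: le_esum => t _ /=; rewrite -ue ger0_norm.
  split => //.
  rewrite rsum_ge0E// [RHS]rsum_ge0E//; congr fine; rewrite -e.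
  by apply: eq_esum => t _; rewrite ue.
move=> sa; pose v t s := `|a t s|; pose u t s := `|a t s| + a t s.
have sv : asummable (fun p => v p.1 p.2) by apply: asummable_le sa => p; rewrite normr_id.
have su : asummable (fun p => u p.1 p.2) by apply: asummableD.
have [||sv1 sv2 ev] := pos v => //; first by move=> t s; rewrite normr_ge0.
have [||su1 su2 eu] := pos u => //; first by move=> t s; rewrite -lerBlDr sub0r -normrN ler_norm.
have ea t : a t = fun s => u t s - v t s by apply/funext => s; rewrite /u /v; lra.
have ert t : rsum (a t) = rsum (u t) - rsum (v t) by rewrite ea rsumB.
split; last split.
- under eq_fun do rewrite ert; exact: asummableB.
- by move=> t; rewrite ea; apply: asummableB.
- under eq_rsum do rewrite ert; rewrite rsumB// eu ev -rsumB//.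
  by apply: eq_rsum => p; rewrite /u /v; lra.
Qed.

Lemma asummable_pair (T1 T2 : choiceType) (a : T1 -> T2 -> R) :
  (forall t, asummable (a t)) -> asummable (fun t => rsum (fun s => `|a t s|)) ->
  asummable (fun p => a p.1 p.2).
Proof.
move=> s1 s2; rewrite /asummable /summable.
have -> : (\esum_(p in [set: T1 * T2]) `|(EFin \o (fun p => a p.1 p.2)) p| =
   \esum_(t in [set: T1]) \esum_(s in [set: T2]) (`|a t s|)%:E)%E.
  by rewrite esum_esum//; congr esum; apply/seteqP; split.
apply: le_lt_trans s2; apply: le_esum => t _ /=.
rewrite ger0_norm; last by apply: rsum_ge0 => s; exact: normr_ge0.
rewrite rsum_ge0E//; last by apply: asummable_le (s1 t) => s; rewrite normr_id.
by rewrite fineK// asummable_fin//; apply: asummable_le (s1 t) => s; rewrite normr_id.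
Qed.

Lemma rsum_exchange (T1 T2 : choiceType) (a : T1 -> T2 -> R) :
  asummable (fun p => a p.1 p.2) ->
  rsum (fun t => rsum (a t)) = rsum (fun s => rsum (fun t => a t s)).
Proof.
move=> sa; have [_ [_ ->]] := asummable_rsum sa.
pose sw (p : T2 * T1) := (p.2, p.1).
have bsw : bijective sw by exists (fun p => (p.2, p.1)) => -[].
rewrite (reindex_rsum _ bsw).
have sa' : asummable (fun p : T2 * T1 => a p.2 p.1) by exact: (asummable_reindex bsw sa).
by have [_ [_ <-]] := @asummable_rsum T2 T1 (fun s t => a t s) sa'.
Qed.

End Rsum.

(** * Weighted sums of functions bounded on the support of the weight *)

Section Wsum.
Context {R : realType}.
Implicit Types (T : choiceType) (c : R).

Definition wsum T (q h : T -> R) : R := rsum (fun t => q t * h t).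

Definition weight T (q : T -> R) := (forall t, 0 <= q t) /\ asummable q.

(** Off the support of [mu] neither conditional averages nor logarithms are controlled, so a bound
    is asked only where the weight is positive. *)
Definition bounded_on T (q h : T -> R) := exists C, forall t, 0 < q t -> `|h t| <= C.

Lemma bounded_on_cst T (q : T -> R) c : bounded_on q (fun=> c).
Proof. by exists `|c|. Qed.

Lemma bounded_onD T (q g h : T -> R) : bounded_on q g -> bounded_on q h ->
  bounded_on q (fun t => g t + h t).
Proof.
move=> [C gC] [D hD]; exists (C + D) => t qt.
by rewrite (le_trans (ler_normD _ _))// lerD ?gC ?hD.
Qed.

Lemma bounded_onN T (q g : T -> R) : bounded_on q g -> bounded_on q (fun t => - g t).
Proof. by move=> [C gC]; exists C => t qt; rewrite normrN gC. Qed.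

Lemma bounded_onB T (q g h : T -> R) : bounded_on q g -> bounded_on q h ->
  bounded_on q (fun t => g t - h t).
Proof. by move=> bg bh; apply: bounded_onD => //; exact: bounded_onN. Qed.

Lemma bounded_onM T (q g h : T -> R) : bounded_on q g -> bounded_on q h ->
  bounded_on q (fun t => g t * h t).
Proof.
move=> [C gC] [D hD]; exists (C * D) => t qt.
by rewrite normrM ler_pM ?gC ?hD.
Qed.

Lemma bounded_on_norm T (q g : T -> R) : bounded_on q g -> bounded_on q (fun t => `|g t|).
Proof. by move=> [C gC]; exists C => t qt; rewrite normr_id gC. Qed.

Lemma bounded_on_itv T (q g : T -> R) a b :
  (forall t, 0 < q t -> a <= g t <= b) -> bounded_on q g.
Proof.
move=> h; exists (Num.max `|a| `|b|) => t /h /andP[ag gb].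
by rewrite le_max !ler_norml; have := ler_norm b; have := ler_norm (- a);
  rewrite normrN; lra.
Qed.

Lemma bounded_on_ln T (q g : T -> R) a b : 0 < a ->
  (forall t, 0 < q t -> a <= g t <= b) -> bounded_on q (fun t => ln (g t)).
Proof.
move=> a0 h; apply: (@bounded_on_itv _ _ _ (ln a) (ln b)) => t /h /andP[ag gb].
have g0 := lt_le_trans a0 ag; have b0 := lt_le_trans g0 gb.
by rewrite !ler_ln ?posrE// ag.
Qed.

Lemma asummable_bounded T (q h : T -> R) : weight q -> bounded_on q h ->
  asummable (fun t => q t * h t).
Proof.
move=> [q0 sq] [C hC]; apply: asummable_le (asummableZ C sq) => t /=.
have [->|qt] := eqVneq (q t) 0; first by rewrite mul0r mulr0.
have {}qt : 0 < q t by rewrite lt_neqAle eq_sym qt q0.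
rewrite mulrC !normrM ler_wpM2r//; apply: le_trans (hC _ qt) (ler_norm _).
Qed.

Lemma eq_wsum T (q g h : T -> R) : (forall t, 0 <= q t) ->
  (forall t, 0 < q t -> g t = h t) -> wsum q g = wsum q h.
Proof.
move=> q0 gh; apply: eq_rsum => t.
have [->|qt] := eqVneq (q t) 0; first by rewrite !mul0r.
by rewrite gh// lt_neqAle eq_sym qt q0.
Qed.

Lemma wsumD T (q g h : T -> R) : weight q -> bounded_on q g -> bounded_on q h ->
  wsum q (fun t => g t + h t) = wsum q g + wsum q h.
Proof.
move=> wq bg bh; rewrite -rsumD; try exact: asummable_bounded.
by apply: eq_rsum => t; rewrite mulrDr.
Qed.

Lemma wsumB T (q g h : T -> R) : weight q -> bounded_on q g -> bounded_on q h ->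
  wsum q (fun t => g t - h t) = wsum q g - wsum q h.
Proof.
move=> wq bg bh; rewrite -rsumB; try exact: asummable_bounded.
by apply: eq_rsum => t; rewrite mulrBr.
Qed.

Lemma wsumZ T (q g : T -> R) c : weight q -> bounded_on q g ->
  wsum q (fun t => c * g t) = c * wsum q g.
Proof.
move=> wq bg; rewrite -rsumZ; try exact: asummable_bounded.
by apply: eq_rsum => t; rewrite mulrCA.
Qed.

Lemma wsum_cst T (q : T -> R) c : weight q -> wsum q (fun=> c) = c * rsum q.
Proof. by move=> [q0 sq]; rewrite -rsumZ//; apply: eq_rsum => t; rewrite mulrC. Qed.

Lemma ler_wsum T (q g h : T -> R) : weight q -> bounded_on q g -> bounded_on q h ->
  (forall t, 0 < q t -> g t <= h t) -> wsum q g <= wsum q h.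
Proof.
move=> wq bg bh gh; apply: le_rsum; try exact: asummable_bounded.
move=> t; have [->|qt] := eqVneq (q t) 0; first by rewrite !mul0r.
have {}qt : 0 < q t by rewrite lt_neqAle eq_sym qt; case: wq => ->.
by rewrite ler_wpM2l ?gh// ltW.
Qed.

Lemma wsum_ge0 T (q h : T -> R) : (forall t, 0 <= q t) ->
  (forall t, 0 < q t -> 0 <= h t) -> 0 <= wsum q h.
Proof.
move=> q0 h0; apply: rsum_ge0 => t.
have [->|qt] := eqVneq (q t) 0; first by rewrite !mul0r.
by rewrite mulr_ge0// h0// lt_neqAle eq_sym qt q0.
Qed.

Lemma bounded_on_sub T (q q' h : T -> R) : (forall t, 0 < q t -> 0 < q' t) ->
  bounded_on q' h -> bounded_on q h.
Proof. by move=> qq' [C hC]; exists C => t /qq' /hC. Qed.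

Lemma le_weight_gt0 T (q q' : T -> R) c : (forall t, 0 <= q' t) ->
  (forall t, q t <= c * q' t) -> forall t, 0 < q t -> 0 < q' t.
Proof.
move=> q'0 qq' t qt; rewrite lt_neqAle q'0 andbT; apply/eqP => q't.
by move: (qq' t); rewrite -q't mulr0 leNgt qt.
Qed.

Lemma ler_wsum_weight T (q q' h : T -> R) c : weight q -> weight q' ->
  bounded_on q' h -> (forall t, q t <= c * q' t) ->
  (forall t, 0 < q' t -> 0 <= h t) -> wsum q h <= c * wsum q' h.
Proof.
move=> wq wq' bh qq' h0; rewrite -rsumZ; last exact: asummable_bounded.
have s := le_weight_gt0 (proj1 wq') qq'.
apply: le_rsum; first exact: asummable_bounded (bounded_on_sub s bh).
  exact/asummableZ/asummable_bounded.
move=> t; have [q't|q't] := eqVneq (q' t) 0; last first.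
  by rewrite mulrA ler_wpM2r// h0// lt_neqAle eq_sym q't; case: wq' => ->.
have := qq' t; rewrite q't mulr0 mul0r mulr0 => qt.
have -> : q t = 0 by apply/eqP; rewrite eq_le qt; case: wq => ->.
by rewrite mul0r.
Qed.

Lemma ler_norm_wsum T (q h : T -> R) : weight q -> bounded_on q h ->
  `|wsum q h| <= wsum q (fun t => `|h t|).
Proof.
move=> wq bh; have bh' := bounded_on_norm bh; rewrite ler_norml; apply/andP; split.
  rewrite -[leLHS]mulN1r -wsumZ//; apply: ler_wsum => //.
    by apply: bounded_onM => //; exact: bounded_on_cst.
  by move=> t _; rewrite mulN1r lerNl -normrN ler_norm.
by apply: ler_wsum => // t _; exact: ler_norm.
Qed.

End Wsum.

Ltac bounded := first [ assumption | exact: bounded_on_cst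
  | (apply: bounded_onB; bounded) | (apply: bounded_onD; bounded)
  | (apply: bounded_onM; bounded) | (apply: bounded_onN; bounded)
  | (apply: bounded_on_norm; bounded)].

(** * Logarithmic inequalities *)

Section LogIneq.
Context {R : realType}.
Implicit Types (a b c d u v : R).

Lemma ln_le_sub1 u : 0 < u -> ln u <= u - 1.
Proof. by move=> u0; have := @le_ln1Dx R (u - 1); rewrite subrKC; apply; lra. Qed.

Lemma lnB_le u v : 0 < u -> 0 < v -> ln u - ln v <= u / v - 1.
Proof. by move=> u0 v0; rewrite -ln_div ?posrE// ln_le_sub1// divr_gt0. Qed.

Lemma mul_lnB_le u v : 0 < u -> 0 < v -> v * (ln u - ln v) <= u - v.
Proof.
move=> u0 v0; have := lnB_le u0 v0; rewrite -(ler_pM2l v0).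
by rewrite [in X in _ <= X -> _]mulrBr mulr1 mulrCA divff ?mulr1// gt_eqF.
Qed.

(** Both chords are compared with the tangent of [ln] at the common point [b], of slope [1 / b]:
    concavity cleared of denominators. *)
Lemma ln_slope_pivot a b c : 0 < c -> c <= b -> b <= a ->
  (b - c) * (ln a - ln b) <= (a - b) * (ln b - ln c).
Proof.
move=> c0 cb ba; have b0 := lt_le_trans c0 cb; have a0 := lt_le_trans b0 ba.
have h1 := mul_lnB_le a0 b0; have h2 := mul_lnB_le c0 b0.
rewrite -(ler_pM2l b0).
have : (b - c) * (b * (ln a - ln b)) <= (b - c) * (a - b) by rewrite ler_wpM2l ?subr_ge0.
have : (a - b) * (b * (ln c - ln b)) <= (a - b) * (c - b) by rewrite ler_wpM2l ?subr_ge0.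
by nra.
Qed.

(** Monotonicity of the logarithmic mean in both arguments, cross-multiplied. Each chord is compared
    with the one over [[v, a]], so that one endpoint moves at a time. *)
Lemma ln_slope u v a b : 0 < v -> v < u -> u <= a -> v <= b -> b < a ->
  (u - v) * (ln a - ln b) <= (a - b) * (ln u - ln v).
Proof.
move=> v0 vu ua vb ba.
have h1 := ln_slope_pivot v0 (ltW vu) ua.
have h2 := ln_slope_pivot v0 vb (ltW ba).
have va : 0 < a - v by rewrite subr_gt0 (lt_le_trans vu).
rewrite -(ler_pM2l va).
have e1 : (u - v) * (ln a - ln v) <= (a - v) * (ln u - ln v) by lra.
have e2 : (a - v) * (ln a - ln b) <= (a - b) * (ln a - ln v) by lra.
have := ler_wpM2l (ltW (etrans (subr_gt0 _ _) vu)) e2.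
have := ler_wpM2l (ltW (etrans (subr_gt0 _ _) ba)) e1.
lra.
Qed.

(** With [u = exp (2 s)] this reads [tanh s <= s] for [s >= 0]. The difference [g] of the two sides
    vanishes at 1 and has the nonnegative derivative [ln t - 1 + 1 / t]. *)
Lemma ln_ge_tanh u : 1 <= u -> 2 * (u - 1) <= (u + 1) * ln u.
Proof.
move=> u1; pose g (t : R) := (t + 1) * ln t - 2 * (t - 1).
have dg (t : R) : 1 <= t -> is_derive t 1 g (ln t - 1 + t^-1).
  move=> t1; have t0 : 0 < t by lra.
  have dl := is_derive1_ln t0.
  rewrite /g; apply: is_derive_eq.
  rewrite /GRing.scale /=. field; lra.
have cg : {within `[1, u], continuous g}.
  apply: derivable_within_continuous => t; rewrite in_itv /= => /andP[t1 _].
  by have [] := dg t t1.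
have [|c] := @MVT_segment R g (fun t => ln t - 1 + t^-1) 1 u u1 _ cg.
  by move=> t; rewrite in_itv /= => /andP[t1 _]; apply: dg; exact: ltW.
rewrite in_itv /= => /andP[c1 _].
rewrite /g ln1 => e.
have c0 : 0 < c by lra.
have : 0 <= (ln c - 1 + c^-1) * (u - 1).
  rewrite mulr_ge0 ?subr_ge0//.
  have := lnB_le ltr01 c0; rewrite ln1; lra.
by lra.
Qed.

(** The logarithmic mean is at most the arithmetic mean, in a form that also covers [u = v]. *)
Lemma sqr_sub_le_ln u v : 0 < u -> 0 < v ->
  2 * (u - v) ^+ 2 <= (u + v) * ((u - v) * (ln u - ln v)).
Proof.
wlog vu : u v / v <= u.
  move=> h u0 v0; have [vu|/ltW uv] := leP v u; first exact: h.
  by have := h _ _ uv v0 u0; lra.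
move=> u0 v0; have := @ln_ge_tanh (u / v).
rewrite ler_pdivlMr// mul1r => /(_ vu).
rewrite ln_div ?posrE// -(ler_pM2r v0).
have -> : 2 * (u / v - 1) * v = 2 * (u - v) by field; rewrite gt_eqF.
have -> : (u / v + 1) * (ln u - ln v) * v = (u + v) * (ln u - ln v).
  by field; rewrite gt_eqF.
by move=> h; have := ler_wpM2l (etrans (subr_ge0 _ _) vu) h; lra.
Qed.


(** The function [(u - v) * (ln u - ln v)] is jointly convex and 1-homogeneous; the left side is its
    tangent plane along the ray [u = r * v]. *)
Lemma log_sum_tangent u v r : 0 < u -> 0 < v -> 0 < r ->
  u * (ln r + 1 - r^-1) + v * (1 - ln r - r) <= (u - v) * (ln u - ln v).
Proof.
move=> u0 v0 r0; have h1 := mul_lnB_le (mulr_gt0 r0 v0) u0.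
have h2 := mul_lnB_le (divr_gt0 u0 r0) v0.
rewrite lnM ?posrE// in h1; rewrite ln_div ?posrE// in h2.
lra.
Qed.


Lemma lnB_mul_ge0 u v : 0 < u -> 0 < v -> 0 <= (u - v) * (ln u - ln v).
Proof.
move=> u0 v0; have [uv|/ltW vu] := leP u v.
  by rewrite mulr_le0// subr_le0// ler_ln ?posrE.
by rewrite mulr_ge0// subr_ge0// ler_ln ?posrE.
Qed.

End LogIneq.

(** * Averages and the logarithmic mean *)

Section PairInequality.
Context {R : realType} {T : choiceType}.
Variables (e M : R) (e0 : 0 < e).
Implicit Types (b q u v : T -> R).

Lemma rsum_weight_ge0 q : weight q -> 0 <= rsum q.
Proof. by move=> [q0 _]; apply: rsum_ge0. Qed.

Lemma wsum_itv q v : weight q -> rsum q = 1 ->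
  (forall t, 0 < q t -> e <= v t <= M) -> e <= wsum q v <= M.
Proof.
move=> wq q1 vb; have bv := bounded_on_itv vb.
have := @ler_wsum _ _ q (fun=> e) v wq (bounded_on_cst _ _) bv.
have := @ler_wsum _ _ q v (fun=> M) wq bv (bounded_on_cst _ _).
rewrite !wsum_cst// q1 !mulr1 => h1 h2; apply/andP; split.
  by apply: h2 => t /vb /andP[].
by apply: h1 => t /vb /andP[].
Qed.

(** Jensen's inequality for [(u - v) * (ln u - ln v)]. Homogeneity allows any total mass of [b], and
    the tangent plane at the ratio [r] of the two totals is exact at these totals. *)
Lemma log_sum b u v : weight b ->
  (forall t, 0 < b t -> e <= u t <= M) -> (forall t, 0 < b t -> e <= v t <= M) ->
  wsum b v < wsum b u ->
  0 < wsum b v /\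
  (wsum b u - wsum b v) * (ln (wsum b u) - ln (wsum b v)) <=
  wsum b (fun t => (u t - v t) * (ln (u t) - ln (v t))).
Proof.
move=> wb ub vb UV.
have bu := bounded_on_itv ub; have bv := bounded_on_itv vb.
have blu := bounded_on_ln e0 ub; have blv := bounded_on_ln e0 vb.
have ge w : (forall t, 0 < b t -> e <= w t <= M) -> e * rsum b <= wsum b w.
  move=> wb'; rewrite -wsum_cst//; apply: ler_wsum => //; first exact: bounded_on_cst.
    exact: bounded_on_itv wb'.
  by move=> t /wb' /andP[].
have le w : (forall t, 0 < b t -> e <= w t <= M) -> wsum b w <= M * rsum b.
  move=> wb'; rewrite -wsum_cst//; apply: ler_wsum => //; last by move=> t /wb' /andP[].
    exact: bounded_on_itv wb'.
  exact: bounded_on_cst.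
have rb : 0 < rsum b.
  rewrite lt_neqAle rsum_weight_ge0// andbT eq_sym; apply/eqP => rb.
  by have := ge _ vb; have := le _ ub; rewrite rb !mulr0; lra.
have V0 : 0 < wsum b v by apply: lt_le_trans (ge _ vb); rewrite mulr_gt0.
have U0 : 0 < wsum b u by apply: lt_trans UV.
split => //; set U := wsum b u; set V := wsum b v; pose r := U / V.
have r0 : 0 < r by rewrite divr_gt0.
have -> : (U - V) * (ln U - ln V) =
   wsum b (fun t => (ln r + 1 - r^-1) * u t + (1 - ln r - r) * v t).
  rewrite wsumD ?wsumZ//; last 2 first.
  - by apply: bounded_onM => //; exact: bounded_on_cst.
  - by apply: bounded_onM => //; exact: bounded_on_cst.
  rewrite -/U -/V -ln_div ?posrE// -/r /r invf_div; field.
  by rewrite !gt_eqF.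
apply: ler_wsum => //.
- by apply: bounded_onD; apply: bounded_onM => //; exact: bounded_on_cst.
- by apply: bounded_onM; apply: bounded_onB.
- move=> t bt; have /andP[u1 _] := ub _ bt; have /andP[v1 _] := vb _ bt.
  have := log_sum_tangent (lt_le_trans e0 u1) (lt_le_trans e0 v1) r0.
  by rewrite [u t * _]mulrC [v t * _]mulrC.
Qed.

(** By [log_sum], the square is at most the sum on the right times the logarithmic mean of
    [wsum b u] and [wsum b v]. By monotonicity and homogeneity that mean is at most [c] times the
    logarithmic mean of [F'] and [F]. *)
Lemma sqr_wsum_diff_le b u v (c F F' : R) : weight b ->
  (forall t, 0 < b t -> e <= u t <= M) -> (forall t, 0 < b t -> e <= v t <= M) ->
  0 < F -> F < F' -> wsum b u <= c * F' -> wsum b v <= c * F ->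
  0 < wsum b (fun t => u t - v t) ->
  wsum b (fun t => u t - v t) ^+ 2 <=
  c * wsum b (fun t => (u t - v t) * (ln (u t) - ln (v t))) *
  ((F' - F) / (ln F' - ln F)).
Proof.
move=> wb ub vb F0 FF' uc vc.
have bu := bounded_on_itv ub; have bv := bounded_on_itv vb.
rewrite wsumB// subr_gt0 => UV; have [V0 ls] := log_sum wb ub vb UV.
set S := wsum b (fun t => (u t - v t) * _) in ls *; set U := wsum b u in uc UV ls *.
set V := wsum b v in vc V0 UV ls *.
have F'0 : 0 < F' by apply: lt_trans FF'.
have c0 : 0 < c.
  by rewrite -(pmulr_lgt0 c F0) (lt_le_trans V0).
have l0 : 0 < ln F' - ln F by rewrite subr_gt0 ltr_ln ?posrE.
rewrite mulrA ler_pdivlMr//.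
have := ln_slope V0 UV uc vc; rewrite ltr_pM2l// => /(_ FF').
rewrite !lnM ?posrE// => sl.
have UV0 : 0 <= U - V by lra.
have := ler_wpM2l UV0 sl.
have := ler_wpM2l (mulr_ge0 (ltW c0) (etrans (subr_ge0 _ _) (ltW FF'))) ls.
lra.
Qed.

(** Cauchy-Schwarz applied to the pointwise bound [sqr_sub_le_ln]: the arithmetic mean [(v + F) / 2]
    again averages to [F]. *)
Lemma sqr_mean_dev q v : weight q -> rsum q = 1 ->
  (forall t, 0 < q t -> e <= v t <= M) ->
  wsum q (fun t => `|v t - wsum q v|) ^+ 2 <=
  wsum q v * wsum q (fun t => (v t - wsum q v) * (ln (v t) - ln (wsum q v))).
Proof.
move=> wq q1 vb; have bv := bounded_on_itv vb; have blv := bounded_on_ln e0 vb.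
have /andP[Fe _] := wsum_itv wq q1 vb.
have [F eF] : exists F, F = wsum q v by exists (wsum q v).
rewrite -eF in Fe *; have F0 : 0 < F by exact: lt_le_trans Fe.
set K := wsum q (fun t => (v t - F) * _); set X := wsum q _.
have bc c : bounded_on q (fun=> c) by exact: bounded_on_cst.
have bd : bounded_on q (fun t => v t - F) by exact: bounded_onB.
have bK : bounded_on q (fun t => (v t - F) * (ln (v t) - ln F)).
  by apply: bounded_onM => //; exact: bounded_onB.
have X0 : 0 <= X by apply: wsum_ge0 => //; case: wq.
have K0 : 0 <= K.
  apply: wsum_ge0; first by case: wq.
  by move=> t /vb /andP[vt _]; apply: lnB_mul_ge0 => //; exact: lt_le_trans vt.
(* Cauchy-Schwarz with a free parameter: AM-GM at each point, then integration, where [v + F] has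
   mean [2 F]. *)
have key l : 0 < l -> X <= (l * K + F / l) / 2.
  move=> l0.
  have -> : (l * K + F / l) / 2 = wsum q (fun t => l / 2 * ((v t - F) * (ln (v t) - ln F)) +
      (4 * l)^-1 * (v t + F)).
    rewrite wsumD ?wsumZ ?wsumD//; try bounded.
    by rewrite wsum_cst// q1 mulr1 -eF -/K; field; rewrite gt_eqF.
  apply: ler_wsum => //; try bounded.
  - move=> t /vb /andP[vt _]; have v0 := lt_le_trans e0 vt.
    have := sqr_sub_le_ln v0 F0; rewrite -(real_normK (num_real (v t - F))).
    set n := `|v t - F|; set s := _ * (ln _ - _); set m := v t + F => h.
    have n0 : 0 <= n by exact: normr_ge0.
    have s0 : 0 <= s by exact: lnB_mul_ge0.
    have m0 : 0 < m by rewrite addr_gt0.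
    have -> : l / 2 * s + (4 * l)^-1 * m = (2 * l ^+ 2 * s + m) / (4 * l).
      by field; rewrite gt_eqF.
    rewrite ler_pdivlMr; last lra.
    (* AM-GM *)
    have sq : (4 * l * n) ^+ 2 <= (2 * l ^+ 2 * s + m) ^+ 2.
      have := sqr_ge0 (2 * l ^+ 2 * s - m).
      have := ler_wpM2l (sqr_ge0 (2 * l)) h; lra.
    rewrite -ler_sqr ?nnegrE; first by rewrite [n * _]mulrC.
    - by rewrite mulr_ge0//; lra.
    - by rewrite addr_ge0 ?(ltW m0)// mulr_ge0// mulr_ge0// sqr_ge0.
have [->|Xn0] := eqVneq X 0; first by rewrite expr0n /= mulr_ge0// ltW.
have Xp : 0 < X by rewrite lt_neqAle eq_sym Xn0.
(* If [K = 0], the parameter [F / X] gives [X <= X / 2], against [0 < X]. Otherwise [X / K] gives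
   the claim without square roots. *)
have [K00|Kn0] := eqVneq K 0.
  have := key (F / X) (divr_gt0 F0 Xp); rewrite K00 mulr0 add0r invf_div mulrCA divff ?gt_eqF//.
  lra.
have Kp : 0 < K by rewrite lt_neqAle eq_sym Kn0.
have := key (X / K) (divr_gt0 Xp Kp).
rewrite -mulrA mulVf ?gt_eqF// mulr1 invf_div => h.
have {h} : X <= F * (K / X) by lra.
by rewrite mulrA ler_pdivlMr.
Qed.

End PairInequality.

(** * Increment of a conditional mean between neighbouring configurations *)

Section PairIncrement.
Context {R : realType} {T : choiceType}.
Variables (e M : R) (e0 : 0 < e).
Implicit Types (b q u v : T -> R).

(** The centre is [d / 2] below the supremum of [r] on the support. Centring there instead of at a
    value of [r] halves the bound. *)
Lemma osc_midpoint q (r : T -> R) (d : R) t0 : 0 < q t0 ->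
  (forall t s, 0 < q t -> 0 < q s -> `|r t - r s| <= d) ->
  exists c, forall t, 0 < q t -> `|r t - c| <= d / 2.
Proof.
move=> q0 rd; pose A := [set r t | t in [set t | 0 < q t]].
have ub s : 0 < q s -> ubound A (r s + d).
  by move=> qs _ [t qt <-]; have := rd t s qt qs; rewrite ler_norml; lra.
have hs : has_sup A by split; [exists (r t0), t0|exists (r t0 + d); exact: ub].
exists (sup A - d / 2) => t qt.
have h1 : r t <= sup A by apply: ub_le_sup; [exact: hs.2|exists t].
have h2 : sup A <= r t + d by apply: ge_sup; [exact: hs.1|exact: ub].
by rewrite ler_norml; lra.
Qed.

(** The difference of the two means is the [q]-covariance of [v] with the density [q' / q]. It is at
    most half the oscillation of the density times the mean deviation of [v], which [sqr_mean_dev]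
    bounds. *)
Lemma sqr_cov_le q (q' v : T -> R) (d : R) : weight q -> weight q' -> rsum q = 1 -> rsum q' = 1 ->
  (forall t, q t = 0 -> q' t = 0) ->
  (forall t s, 0 < q t -> 0 < q s -> `|q' t / q t - q' s / q s| <= d) ->
  (forall t, 0 < q t -> e <= v t <= M) ->
  (wsum q' v - wsum q v) ^+ 2 <= d ^+ 2 / 4 *
  (wsum q v * wsum q (fun t => (v t - wsum q v) * (ln (v t) - ln (wsum q v)))).
Proof.
move=> wq wq' q1 q'1 qq' hd vb; have [q0 _] := wq; have [q'0 _] := wq'.
have bv := bounded_on_itv vb.
have [t0 qt0] : exists t, 0 < q t.
  apply/not_existsP => h; have := q1.
  rewrite (_ : rsum q = 0) => [/eqP|]; first by rewrite eq_sym oner_eq0.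
  rewrite -[RHS](@rsum0 R T); apply: eq_rsum => t; apply/eqP; rewrite eq_le q0 andbT.
  by rewrite leNgt; apply/negP/h.
have [c hc] := osc_midpoint qt0 hd.
have [F eF] : exists F, F = wsum q v by exists (wsum q v).
have pos t : q t != 0 -> 0 < q t by move=> qt; rewrite lt_neqAle eq_sym qt q0.
pose r t := q' t / q t.
have br : bounded_on q r.
  by apply: (@bounded_on_itv _ _ _ _ (c - d / 2) (c + d / 2)) => t /hc; rewrite /r ler_norml; lra.
have eq' h : wsum q' h = wsum q (fun t => r t * h t).
  apply: eq_rsum => t; have [qt|/pos qt] := eqVneq (q t) 0; first by rewrite qt qq' ?mul0r.
  by rewrite /r mulrA [q t * _]mulrC divfK// gt_eqF.
(* Both centrings are free: [F] may be subtracted from [v] because [q] and [q'] have equal mass, and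
   [c] from [r] because [v - F] has [q]-mean zero. *)
have e1 : wsum q' v - wsum q v = wsum q (fun t => (r t - c) * (v t - F)).
  rewrite eq' -wsumB//; last by bounded.
  set X := wsum q (fun t => r t * v t - v t).
  have -> : wsum q (fun t => (r t - c) * (v t - F)) =
    wsum q (fun t => (r t * v t - v t) - F * (r t * 1) + (F * c + (1 - c) * v t)).
    by apply: eq_wsum => // t _; ring.
  rewrite wsumD//; try bounded.
  rewrite [X in _ = X + _]wsumB//; try bounded.
  rewrite -/X (wsumZ F)//; last bounded.
  rewrite -eq' (wsum_cst 1)// q'1 wsumD//; try bounded.
  by rewrite (wsum_cst (F * c))// q1 wsumZ// -eF; lra.
rewrite e1 -eF; have d0 : 0 <= d.
  by have := hc _ qt0; have := normr_ge0 (q' t0 / q t0 - c); lra.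
have bF : bounded_on q (fun t => v t - F) by bounded.
have := sqr_mean_dev e0 wq q1 vb; rewrite -eF.
set X := wsum q (fun t => `|_|) => hX.
have hY : `|wsum q (fun t => (r t - c) * (v t - F))| <= d / 2 * X.
  apply: le_trans (ler_norm_wsum _ _) _ => //; first by bounded.
  rewrite /X -wsumZ//; last bounded.
  apply: ler_wsum => //; try bounded.
  by move=> t /hc h; rewrite normrM ler_wpM2r.
rewrite -(real_normK (num_real (wsum q _))).
have X0 : 0 <= X by apply: wsum_ge0.
apply: (@le_trans _ _ ((d / 2 * X) ^+ 2)).
  by rewrite ler_sqr ?nnegrE// mulr_ge0// divr_ge0.
have -> : (d / 2 * X) ^+ 2 = d ^+ 2 / 4 * X ^+ 2 by field.
by rewrite ler_wpM2l// divr_ge0// sqr_ge0.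
Qed.

(* [F = wsum q v] and [F' = wsum q' u] play the role of [mu_k g] at two
   configurations differing at [i].  In [F' - F = G + Cov], with
   [G = wsum q' (u - v)], the three quantities [A = wsum b (u - v)], [G] and [Cov]
   are controlled by the logarithmic mean [L = (F' - F) / (ln F' - ln F) >= F]. *)
Lemma pair_ineq b q (q' u v : T -> R) (a1 a2 m0 p0 d : R) :
  weight b -> weight q -> weight q' -> rsum q = 1 -> rsum q' = 1 ->
  0 <= a1 -> 0 <= a2 -> 0 < m0 -> 0 <= p0 ->
  (forall t, b t <= a2 * m0 * q' t) -> (forall t, m0 * q' t <= a2 * b t) ->
  (forall t, b t <= a2 * p0 * q t) ->
  (forall t, q' t <= a1 * q t) -> (forall t, q t <= a1 * q' t) ->
  (forall t s, 0 < q t -> 0 < q s -> `|q' t / q t - q' s / q s| <= d) ->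
  (forall t, 0 < q t -> e <= u t <= M) -> (forall t, 0 < q t -> e <= v t <= M) ->
  wsum q v < wsum q' u ->
  wsum b (fun t => u t - v t) * (ln (wsum q' u) - ln (wsum q v)) <=
  a1 * a2 * wsum b (fun t => (u t - v t) * (ln (u t) - ln (v t))) +
  d / 4 * (wsum b (fun t => (u t - v t) * (ln (u t) - ln (v t))) +
    a1 * a2 * p0 * wsum q (fun t => (v t - wsum q v) * (ln (v t) - ln (wsum q v)))).
Proof.
move=> wb wq wq' q1 q'1 a10 a20 m00 p00 bm mb bp q'q qq' hd ub vb FF'.
have [q0 _] := wq; have [q'0 _] := wq'.
have q'q0 t : q t = 0 -> q' t = 0.
  by move=> qt; apply/eqP; rewrite eq_le q'0 andbT; have := q'q t; rewrite qt mulr0.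
have sq' := le_weight_gt0 q0 q'q.
have sb := le_weight_gt0 q0 bp.
have ub' t : 0 < q' t -> e <= u t <= M by move=> /sq' /ub.
have vb' t : 0 < q' t -> e <= v t <= M by move=> /sq' /vb.
have ubb t : 0 < b t -> e <= u t <= M by move=> /sb /ub.
have vbb t : 0 < b t -> e <= v t <= M by move=> /sb /vb.
have cov := sqr_cov_le wq wq' q1 q'1 q'q0 hd vb.
have /andP[Fe _] := wsum_itv wq q1 vb.
have F0 := lt_le_trans e0 Fe; have F'0 := lt_trans F0 FF'.
have pos w : e <= w <= M -> 0 < w by move=> /andP[we _]; exact: lt_le_trans we.
have sge t : 0 < q t -> 0 <= (u t - v t) * (ln (u t) - ln (v t)).
  by move=> qt; apply: lnB_mul_ge0; [exact: pos (ub _ qt)|exact: pos (vb _ qt)].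
have uge t : 0 < q t -> 0 <= u t by move=> /ub /pos /ltW.
have vge t : 0 < q t -> 0 <= v t by move=> /vb /pos /ltW.
have d0 : 0 <= d.
  have [t qt] : exists t, 0 < q t.
    apply/not_existsP => h; have := F0; rewrite (_ : wsum q v = 0) ?ltxx//.
    rewrite -[RHS](@rsum0 R T); apply: eq_rsum => t.
    have -> : q t = 0 by apply/eqP; rewrite eq_le q0 andbT leNgt; apply/negP/h.
    by rewrite mul0r.
  by apply: le_trans (hd t t qt qt).
have bu := bounded_on_itv ub; have bv := bounded_on_itv vb.
have bu' := bounded_on_itv ub'; have bv' := bounded_on_itv vb'.
have blu := bounded_on_ln e0 ub; have blv := bounded_on_ln e0 vb.
have blu' := bounded_on_ln e0 ub'; have blv' := bounded_on_ln e0 vb'.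
have blub := bounded_on_ln e0 ubb; have blvb := bounded_on_ln e0 vbb.
have bub := bounded_on_itv ubb; have bvb := bounded_on_itv vbb.
have a11 : 1 <= a1.
  have := ler_wsum_weight wq wq' (bounded_on_cst q' 1) qq' (fun _ _ => ler01).
  by rewrite !wsum_cst// q1 q'1 !mulr1.
have qv' : wsum q' v <= a1 * wsum q v by apply: ler_wsum_weight.
have qu : wsum q u <= a1 * wsum q' u.
  by apply: ler_wsum_weight => // t /sq' /uge.
(* The averages against [b] are compared with [F'] and [F] in two ways, through [q'] with constant
   [m0] and through [q] with constant [p0]. In each case one constant serves both [u] and [v], as
   [sqr_wsum_diff_le] requires. *)
have c1 : wsum b u <= (a1 * a2 * m0) * wsum q' u.
  have h : wsum b u <= a2 * m0 * wsum q' u by apply: ler_wsum_weight => // t /sq' /uge.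
  have := ler_wpM2r (mulr_ge0 (mulr_ge0 a20 (ltW m00)) (ltW F'0)) a11; lra.
have c2 : wsum b v <= (a1 * a2 * m0) * wsum q v.
  have h : wsum b v <= a2 * m0 * wsum q' v by apply: ler_wsum_weight => // t /sq' /vge.
  have := ler_wpM2l (mulr_ge0 a20 (ltW m00)) qv'; lra.
have c3 : wsum b u <= (a1 * a2 * p0) * wsum q' u.
  have h : wsum b u <= a2 * p0 * wsum q u by apply: ler_wsum_weight.
  have := ler_wpM2l (mulr_ge0 a20 p00) qu; lra.
have c4 : wsum b v <= (a1 * a2 * p0) * wsum q v.
  have h : wsum b v <= a2 * p0 * wsum q v by apply: ler_wsum_weight.
  have := ler_wpM2r (mulr_ge0 (mulr_ge0 a20 p00) (ltW F0)) a11; lra.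
have c5 : wsum q' u <= a1 * wsum q' u by rewrite ler_peMl// ltW.
have sA c := sqr_wsum_diff_le e0 wb ubb vbb F0 FF' (c := c).
have sG c := sqr_wsum_diff_le e0 wq' ub' vb' F0 FF' (c := c).
have {}sA1 := sA _ c1 c2; have {sA} sA2 := sA _ c3 c4.
have {sG} sG := sG _ c5 qv'.
have SS : wsum q' (fun t => (u t - v t) * (ln (u t) - ln (v t))) <=
    a2 / m0 * wsum b (fun t => (u t - v t) * (ln (u t) - ln (v t))).
  apply: ler_wsum_weight => //; first by bounded.
    by move=> t; rewrite mulrAC ler_pdivlMr// mulrC.
  by move=> t /sb /sge.
have S0 : 0 <= wsum b (fun t => (u t - v t) * (ln (u t) - ln (v t))).
  by apply: wsum_ge0 => [|t /sb /sge//]; case: wb.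
have S'0 : 0 <= wsum q' (fun t => (u t - v t) * (ln (u t) - ln (v t))).
  by apply: wsum_ge0 => [|t /sq' /sge//]; case: wq'.
have K0 : 0 <= wsum q (fun t => (v t - wsum q v) * (ln (v t) - ln (wsum q v))).
  by apply: wsum_ge0 => // t /vb /pos vt; exact: lnB_mul_ge0.
have eG : wsum q' (fun t => u t - v t) = wsum q' u - wsum q' v by rewrite wsumB.
have Fl := mul_lnB_le F'0 F0.
have l0 : 0 < ln (wsum q' u) - ln (wsum q v) by rewrite subr_gt0 ltr_ln ?posrE.
move: sA1 sA2 sG SS S0 S'0 K0 eG Fl l0 cov FF' F0.
move: (wsum b (fun t => u t - v t)) (wsum q' (fun t => u t - v t)) => A G.
move: (wsum q (fun t => (v t - _) * _)) => K.
move: (wsum b (fun t => (u t - v t) * _)) (wsum q' (fun t => (u t - v t) * _)) => S S'.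
move: (wsum q' u) (wsum q v) (wsum q' v) => F' F H.
move: (ln F' - ln F) => l.
move=> sA1 sA2 sG SS S0 S'0 K0 eG Fl l0 cov FF' F0.
have R0 : 0 <= a1 * a2 * S + d / 4 * (S + a1 * a2 * p0 * K).
  by rewrite !(addr_ge0, mulr_ge0).
have [A0|A0] := leP A 0; first by apply: le_trans R0; rewrite mulr_le0_ge0// ltW.
have {}sA1 := sA1 A0; have {}sA2 := sA2 A0.
have [L eL] : exists L, L = (F' - F) / l by exists ((F' - F) / l).
rewrite -eL in sA1 sA2 sG.
have L0 : 0 < L by rewrite eL divr_gt0 ?subr_gt0.
have L0' := ltW L0.
have q4 : 0 <= (4 : R)^-1 by rewrite invr_ge0.
have lE : l * L = F' - F by rewrite eL mulrC divfK ?gt_eqF.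
have FL : F <= L by rewrite eL ler_pdivlMr.
have SL : 0 <= S * L by rewrite mulr_ge0// ltW.
(* The bound on [A ^+ 2] carries [m0] and the one on [G ^+ 2] carries [1 / m0], so the mass ratio
   cancels in the product. *)
have AG : A * G <= a1 * a2 * S * L.
  have [G0|G0] := leP G 0.
    by apply: (@le_trans _ _ 0); [rewrite mulr_ge0_le0// ltW|rewrite -mulrA mulr_ge0// mulr_ge0].
  have {}sG : G ^+ 2 <= a1 * (a2 / m0 * S) * L.
    by apply: le_trans (sG G0) _; apply: ler_wpM2r; [exact: ltW|exact: ler_wpM2l].
  rewrite -ler_sqr ?nnegrE; last 2 first.
  - by rewrite mulr_ge0// ltW.
  - by rewrite -mulrA mulr_ge0// mulr_ge0.
  rewrite exprMn; apply: le_trans (ler_pM (sqr_ge0 _) (sqr_ge0 _) sA1 sG) _.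
  by rewrite le_eqVlt; apply/orP; left; apply/eqP; field; rewrite gt_eqF.
(* Here [A ^+ 2] is bounded with [p0], and [F <= L] absorbs the mean in [cov]. The product of
   squares is at most [(d / 2 * L) ^+ 2 * (S * X)], and AM-GM replaces [S * X] by
   [((S + X) / 2) ^+ 2]. *)
have AC : A * (H - F) <= d / 4 * (S + a1 * a2 * p0 * K) * L.
  set X := a1 * a2 * p0 * K.
  have X0 : 0 <= X by rewrite !mulr_ge0.
  apply: le_trans (ler_norm _) _; rewrite -ler_sqr ?nnegrE//; last first.
    by rewrite !(addr_ge0, mulr_ge0).
  rewrite real_normK ?num_real// exprMn.
  apply: le_trans (ler_pM (sqr_ge0 _) (sqr_ge0 _) sA2 cov) _.
  have h1 : a1 * a2 * p0 * S * L * (d ^+ 2 / 4 * (F * K)) <=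
      a1 * a2 * p0 * S * L * (d ^+ 2 / 4 * (L * K)).
    apply: ler_wpM2l; first by rewrite !mulr_ge0.
    by apply: ler_wpM2l; [rewrite divr_ge0 ?sqr_ge0|exact: ler_wpM2r].
  apply: le_trans h1 _.
  have h2 : 0 <= (d * L) ^+ 2 * (S - X) ^+ 2 by rewrite mulr_ge0// sqr_ge0.
  rewrite /X in h2 *; lra.
have : A * l * L <= (a1 * a2 * S + d / 4 * (S + a1 * a2 * p0 * K)) * L.
  by rewrite -mulrA lE; rewrite eG in AG; lra.
by rewrite ler_pM2r.
Qed.
End PairIncrement.

(** * Configurations and heat bath kernels *)

Section Config.
Context {N : nat} {Omega : 'I_N -> pointedType}.
Implicit Types (x : config Omega) (i k : 'I_N).

Lemma configP x x' : (forall k, x k = x' k) -> x = x'.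
Proof. exact: functional_extensionality_dep. Qed.

Lemma upd_eq x k (y : Omega k) : upd x y k = y.
Proof. exact: dfwithin. Qed.

Lemma upd_neq x k (y : Omega k) j : k != j -> upd x y j = x j.
Proof. exact: dfwithout. Qed.

Lemma upd_id x k : upd x (x k) = x.
Proof. by apply: configP => j; rewrite /upd; case: dfwithP. Qed.

Lemma upd_upd x k (y z : Omega k) : upd (upd x y) z = upd x z.
Proof.
apply: configP => j; have [<-|kj] := eqVneq k j; first by rewrite !upd_eq.
by rewrite !upd_neq.
Qed.

Lemma upd_comm x i k (y : Omega i) (z : Omega k) : i != k ->
  upd (upd x y) z = upd (upd x z) y.
Proof.
move=> ik; apply: configP => j; have [<-|kj] := eqVneq k j.
  by rewrite upd_eq upd_neq// upd_eq.
have [<-|ij] := eqVneq i j; last by rewrite !upd_neq.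
by rewrite upd_eq upd_neq ?upd_eq// eq_sym.
Qed.

Lemma upd_inj x k : injective (@upd N Omega x k).
Proof. by move=> y z /(congr1 (@^~ k)); rewrite !upd_eq. Qed.

Lemma countable_config : (forall k, countable [set: Omega k]) ->
  countable [set: config Omega].
Proof.
move=> cO; have h k : exists f : Omega k -> nat, injective f.
  have /countable_injP[f finj] := cO k; exists f => x y.
  by apply: finj; rewrite inE.
pose f k := projT1 (cid (h k)); have finj k : injective (f k) by exact: (projT2 (cid (h k))).
apply/countable_injP; exists (fun x => pickle [ffun k => f k (x k)]).
move=> x y _ _ /(pcan_inj pickleK) /ffunP fxy; apply: configP => k.
by apply: (finj k); have := fxy k; rewrite !ffunE.
Qed.

End Config.

(** * Integrals over a countable product as weighted sums *)

Section DiscreteIntegral.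
Context {R : realType} {N : nat} {Omega : 'I_N -> pointedType}.
Variable mu : probability (config Omega) R.
Hypothesis countable_Omega : forall k, countable [set: Omega k].

Definition pmass (x : config Omega) : R := fine (mu [set x]).

Lemma pmass_ge0 x : 0 <= pmass x.
Proof. by rewrite fine_ge0. Qed.

Lemma pmassE x : mu [set x] = (pmass x)%:E.
Proof. by rewrite fineK// fin_num_measure. Qed.

(** An injection into the natural numbers splits the space into countably many fibres, each empty or
    a singleton, over which the integral is additive. *)
Lemma ge0_integral_config (g : config Omega -> R) : (forall x, 0 <= g x) ->
  (\int[mu]_x (g x)%:E = \esum_(x in [set: config Omega]) (pmass x * g x)%:E)%E.
Proof.
move=> g0; have /countable_injP[c cinj] := countable_config countable_Omega.
pose F n := [set x | c x = n].
have eT : [set: config Omega] = \bigcup_n F n.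
  by apply/seteqP; split => // x _; exists (c x).
have tF : trivIset setT F.
  by apply/trivIsetP => n p _ _ np; apply/seteqP; split => // x [/= cx cp]; move: np; rewrite -cx -cp eqxx.
rewrite eT ge0_integral_bigcup//; last by move=> x _; rewrite lee_fin.
rewrite esum_bigcupT//; last by move=> x; rewrite lee_fin mulr_ge0// pmass_ge0.
rewrite nneseries_esumT; last by move=> n; apply: integral_ge0 => x _; rewrite lee_fin.
apply: eq_esum => n _.
have [[x Fx]|/nonemptyPn ->] := pselect (F n !=set0); last first.
  by rewrite integral_set0 esum_set0.
have -> : F n = [set x].
  apply/seteqP; split => [y Fy|y ->//]; apply: cinj; rewrite ?inE//.
  by rewrite Fx Fy.
rewrite esum_set1 ?lee_fin ?mulr_ge0 ?pmass_ge0//.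
rewrite (eq_integral (cst (g x)%:E)); last by move=> y; rewrite inE => ->.
by rewrite integral_cst// [X in (_ * X)%E](pmassE x) -EFinM mulrC.
Qed.

Lemma weight_pmass : weight pmass.
Proof.
split; first exact: pmass_ge0.
rewrite /asummable /summable.
have := @ge0_integral_config (fun=> 1) (fun=> ler01).
rewrite integral_cst// mul1e [X in X = _](@probability_setT _ _ _ mu) => e.
apply: (@le_lt_trans _ _ 1%E); last exact: ltry.
by rewrite e; apply: le_esum => x _ /=; rewrite mulr1 ger0_norm// pmass_ge0.
Qed.

Lemma rsum_pmass : rsum pmass = 1.
Proof.
rewrite rsum_ge0E; [|exact: pmass_ge0|exact: (proj2 weight_pmass)].
have := @ge0_integral_config (fun=> 1) (fun=> ler01).
rewrite integral_cst// mul1e [X in X = _](@probability_setT _ _ _ mu) => e.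
by under eq_esum do rewrite -[pmass _]mulr1; rewrite -e.
Qed.

Lemma Rintegral_config (h : config Omega -> R) : bounded_on pmass h ->
  \int[mu]_x h x = wsum pmass h.
Proof.
move=> bh; have fin (g : config Omega -> R) : (forall x, 0 <= g x <= `|h x|) ->
    (\int[mu]_x (g x)%:E)%E \is a fin_num.
  move=> gh; rewrite ge0_integral_config; last by move=> x; have /andP[] := gh x.
  apply: asummable_fin => [x|].
    by have /andP[gx _] := gh x; rewrite mulr_ge0// pmass_ge0.
  apply: asummable_bounded; first exact: weight_pmass.
  have [C hC] := bh; exists C => x /hC; apply: le_trans.
  by have /andP[g0 g1] := gh x; rewrite ger0_norm.
have hp x : 0 <= h^\+ x <= `|h x|.
  by rewrite /funrpos le_max lexx orbT ge_max ler_norm normr_ge0.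
have hn x : 0 <= h^\- x <= `|h x|.
  by rewrite /funrneg le_max lexx orbT ge_max normr_ge0 -normrN ler_norm.
have hp0 x : 0 <= h^\+ x by have /andP[] := hp x.
have hn0 x : 0 <= h^\- x by have /andP[] := hn x.
rewrite /Rintegral integralE.
have -> : ((EFin \o h)^\+ = EFin \o (h^\+)%R)%E.
  by apply/funext => x; rewrite funeposE /= EFin_max.
have -> : ((EFin \o h)^\- = EFin \o (h^\-)%R)%E.
  by apply/funext => x; rewrite funenegE /= EFin_max.
rewrite fineB ?fin// !ge0_integral_config// /wsum /rsum.
congr (fine _ - fine _); apply: eq_esum => x _; congr (_%:E).
  by rewrite /funrpos maxr_pMr ?pmass_ge0// mulr0.
by rewrite /funrneg -mulrN maxr_pMr ?pmass_ge0// mulr0.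
Qed.

End DiscreteIntegral.

Lemma asummable_inj (R : realType) (T T' : choiceType) (e : T -> T') (a : T' -> R) :
  injective e -> asummable a -> asummable (fun t => a (e t)).
Proof.
move=> einj; apply: le_lt_trans.
rewrite -(@esum_image _ _ _ [set: T] e (fun t => `|(a t)%:E|%E)); last first.
  by move=> x y _ _; exact: einj.
by rewrite [leLHS]esum_mkcond; apply: le_esum => t _ /=; case: ifP.
Qed.

(** * Conditional averages and reversibility of a single-site update *)

Section HeatBathOperators.
Context {R : realType} {N : nat} {Omega : 'I_N -> pointedType}.
Variable mu : probability (config Omega) R.
Hypothesis countable_Omega : forall k, countable [set: Omega k].
Implicit Types (x : config Omega) (g h : config Omega -> R) (i k : 'I_N).
Implicit Types (H : config Omega -> config Omega -> R).

Local Notation m := (pmass mu).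
Let m0 := pmass_ge0 mu.
Let wm := weight_pmass mu countable_Omega.
Let bm g := bounded_on m g.

Definition marg k x : R := fine (marginal mu k x).

Lemma asummable_fiber k x : asummable (fun y : Omega k => m (upd x y)).
Proof. by apply: asummable_inj; [exact: upd_inj|exact: (proj2 wm)]. Qed.

Lemma marginalE k x : marginal mu k x = (rsum (fun y : Omega k => m (upd x y)))%:E.
Proof.
rewrite rsum_ge0E//; last exact: asummable_fiber.
rewrite fineK; last by apply: asummable_fin => //; exact: asummable_fiber.
by apply: eq_esum => y _; exact: pmassE.
Qed.

Lemma margE k x : marg k x = rsum (fun y : Omega k => m (upd x y)).
Proof. by rewrite /marg marginalE. Qed.

Lemma marg_ge0 k x : 0 <= marg k x.
Proof. by rewrite margE; apply: rsum_ge0. Qed.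

Lemma marg_gt0E k x : (0 < marginal mu k x)%E = (0 < marg k x).
Proof. by rewrite marginalE lte_fin margE. Qed.

Lemma pmass_le_marg k x : m x <= marg k x.
Proof.
rewrite margE -{1}(upd_id x k).
by apply: (@ler_term_rsum _ _ (fun y => m (upd x y))) => //; exact: asummable_fiber.
Qed.

Lemma marg_gt0 k x : 0 < m x -> 0 < marg k x.
Proof. by move=> mx; apply: lt_le_trans (pmass_le_marg k x). Qed.

Lemma marg_upd k x (z : Omega k) : marg k (upd x z) = marg k x.
Proof. by rewrite !margE; apply: eq_rsum => y; rewrite upd_upd. Qed.

Lemma condpE k x (y : Omega k) : condp mu x y = m (upd x y) / marg k x.
Proof. by []. Qed.

Lemma condp_ge0 k x (y : Omega k) : 0 <= condp mu x y.
Proof. by rewrite condpE divr_ge0// marg_ge0. Qed.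

Lemma condp_upd k x (z y : Omega k) : condp mu (upd x z) y = condp mu x y.
Proof. by rewrite !condpE upd_upd marg_upd. Qed.

Lemma condp_gt0 k x (y : Omega k) : 0 < condp mu x y -> 0 < m (upd x y).
Proof.
rewrite condpE [0 < m _]lt_neqAle m0 andbT => h; apply/eqP => e.
by move: h; rewrite -e mul0r ltxx.
Qed.

Lemma condp_gt0_marg k x (y : Omega k) : 0 < condp mu x y -> 0 < marg k x.
Proof.
rewrite condpE [0 < marg _ _]lt_neqAle marg_ge0 andbT => h; apply/eqP => e.
by move: h; rewrite -e invr0 mulr0 ltxx.
Qed.

Lemma weight_condp k x : weight (@condp R N Omega mu k x).
Proof.
split=> [y|]; first exact: condp_ge0.
apply: asummable_le (asummableZ (marg k x)^-1 (asummable_fiber k x)) => y.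
by rewrite condpE mulrC.
Qed.

Lemma rsum_condp k x : 0 < marg k x -> rsum (@condp R N Omega mu k x) = 1.
Proof.
move=> mx; rewrite (eq_rsum (b := fun y => (marg k x)^-1 * m (upd x y))).
  by rewrite rsumZ ?asummable_fiber// -margE mulVf// gt_eqF.
by move=> y; rewrite condpE mulrC.
Qed.

Local Notation P := (condE mu).

Lemma condE_wsum k g x : P k g x = wsum (@condp R N Omega mu k x) (fun y => g (upd x y)).
Proof. by []. Qed.

Lemma condE_upd k g x (z : Omega k) : P k g (upd x z) = P k g x.
Proof. by apply: eq_rsum => y; rewrite condp_upd upd_upd. Qed.

Lemma bounded_fiber k g x : bm g -> bounded_on (@condp R N Omega mu k x) (fun y => g (upd x y)).
Proof. by move=> [C gC]; exists C => y /condp_gt0; exact: gC. Qed.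

Lemma condE_itv k g x a b : (forall x, 0 < m x -> a <= g x <= b) -> 0 < marg k x ->
  a <= P k g x <= b.
Proof.
move=> gab mx.
have gab' y : 0 < condp mu x y -> a <= g (@upd N Omega x k y) <= b by move=> /condp_gt0 /gab.
have bg := bounded_on_itv gab'.
have := ler_wsum (weight_condp k x) (bounded_on_cst _ a) bg.
have := ler_wsum (weight_condp k x) bg (bounded_on_cst _ b).
rewrite !wsum_cst ?rsum_condp ?mulr1; try exact: weight_condp; try by [].
by move=> h1 h2; rewrite h1 ?h2// => y /gab' /andP[].
Qed.

Lemma bounded_condE k g : bm g -> bm (P k g).
Proof.
move=> [C gC]; apply: (@bounded_on_itv _ _ _ _ (- C) C) => x /(marg_gt0 k).
by apply: condE_itv => y /gC; rewrite ler_norml.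
Qed.

Lemma wsum_condp_cst k x c : 0 < m x -> wsum (@condp R N Omega mu k x) (fun=> c) = c.
Proof.
move=> /(marg_gt0 k) mx; rewrite wsum_cst; last exact: weight_condp.
by rewrite rsum_condp// mulr1.
Qed.

(** The stationary law of one heat bath update at [k], as a law on pairs of configurations before
    and after the update, tested on [H]. *)
Definition bal k H : R :=
  wsum m (fun x => wsum (@condp R N Omega mu k x) (fun y => H x (upd x y))).

Definition bounded2 H := exists C, forall x x', 0 < m x -> 0 < m x' -> `|H x x'| <= C.

Lemma bounded2_cst c : bounded2 (fun _ _ => c).
Proof. by exists `|c|. Qed.

Lemma bounded2_l g : bm g -> bounded2 (fun x _ => g x).
Proof. by move=> [C gC]; exists C => x x' /gC. Qed.

Lemma bounded2_r g : bm g -> bounded2 (fun _ x' => g x').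
Proof. by move=> [C gC]; exists C => x x' _ /gC. Qed.

Lemma bounded2_bool (c : config Omega -> config Omega -> bool) :
  bounded2 (fun x x' => (c x x')%:R).
Proof. by exists 1 => x x' _ _; case: (c x x'); rewrite ?normr1 ?normr0. Qed.

Lemma bounded2D H H' : bounded2 H -> bounded2 H' -> bounded2 (fun x x' => H x x' + H' x x').
Proof.
move=> [C h] [D h']; exists (C + D) => x x' mx mx'.
by rewrite (le_trans (ler_normD _ _))// lerD ?h ?h'.
Qed.

Lemma bounded2N H : bounded2 H -> bounded2 (fun x x' => - H x x').
Proof. by move=> [C h]; exists C => x x' mx mx'; rewrite normrN h. Qed.

Lemma bounded2M H H' : bounded2 H -> bounded2 H' -> bounded2 (fun x x' => H x x' * H' x x').
Proof.
move=> [C h] [D h']; exists (C * D) => x x' mx mx'.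
by rewrite normrM ler_pM ?h ?h'.
Qed.

Lemma bounded2_fiber k H x : bounded2 H -> 0 < m x ->
  bounded_on (@condp R N Omega mu k x) (fun y => H x (upd x y)).
Proof. by move=> [C h] mx; exists C => y /condp_gt0 my; exact: h. Qed.

Lemma bounded_inner k H : bounded2 H ->
  bm (fun x => wsum (@condp R N Omega mu k x) (fun y => H x (upd x y))).
Proof.
move=> bH; have [C h] := bH; exists C => x mx.
apply: le_trans (ler_norm_wsum (weight_condp k x) (bounded2_fiber _ bH mx)) _.
rewrite -[leRHS](@wsum_condp_cst k x C mx); apply: ler_wsum.
- exact: weight_condp.
- exact/bounded_on_norm/bounded2_fiber.
- exact: bounded_on_cst.
- by move=> y /condp_gt0 my; exact: h.
Qed.

Lemma eq_bal k H H' : (forall x x', 0 < m x -> 0 < m x' -> H x x' = H' x x') -> bal k H = bal k H'.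
Proof.
move=> e; apply: eq_wsum => // x mx; apply: eq_wsum => [y|y /condp_gt0 my]; last exact: e.
exact: condp_ge0.
Qed.

Lemma balD k H H' : bounded2 H -> bounded2 H' ->
  bal k (fun x x' => H x x' + H' x x') = bal k H + bal k H'.
Proof.
move=> bH bH'; rewrite -wsumD//; try exact: bounded_inner.
apply: eq_wsum => // x mx; rewrite wsumD//; first exact: weight_condp.
  exact: bounded2_fiber.
exact: bounded2_fiber.
Qed.

Lemma balZ k c H : bounded2 H -> bal k (fun x x' => c * H x x') = c * bal k H.
Proof.
move=> bH; rewrite -wsumZ//; last exact: bounded_inner.
apply: eq_wsum => // x mx; rewrite wsumZ//; first exact: weight_condp.
exact: bounded2_fiber.
Qed.

Lemma ler_bal k H H' : bounded2 H -> bounded2 H' ->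
  (forall x x', 0 < m x -> 0 < m x' -> H x x' <= H' x x') -> bal k H <= bal k H'.
Proof.
move=> bH bH' h; apply: ler_wsum => //; try exact: bounded_inner.
move=> x mx; apply: ler_wsum => //; try exact: bounded2_fiber.
  exact: weight_condp.
by move=> y /condp_gt0 my; exact: h.
Qed.

Lemma asummable_bal k H : bounded2 H ->
  asummable (fun p : config Omega * Omega k => m p.1 * (condp mu p.1 p.2 * H p.1 (upd p.1 p.2))).
Proof.
move=> bH; have inner x : asummable (fun y : Omega k => m x * (condp mu x y * H x (upd x y))).
  have [->|mx] := eqVneq (m x) 0.
    apply: asummable_le (asummable_fiber k x) => y; rewrite mul0r normr0//.
  apply/asummableZ/asummable_bounded; first exact: weight_condp.
  by apply: bounded2_fiber => //; rewrite lt_neqAle eq_sym mx m0.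
apply: (@asummable_pair _ _ _ (fun x (y : Omega k) => m x * (condp mu x y * H x (upd x y)))) => //.
have [C h] := bH.
apply: asummable_le (asummableZ C (proj2 wm)) => x /=.
have [->|mx] := eqVneq (m x) 0.
  by under eq_rsum do rewrite mul0r normr0; rewrite rsum0 mulr0.
have {}mx : 0 < m x by rewrite lt_neqAle eq_sym mx m0.
rewrite ger0_norm; last by apply: rsum_ge0 => y; exact: normr_ge0.
rewrite normrM (ger0_norm (ltW mx)).
under eq_rsum do rewrite normrM (ger0_norm (ltW mx)) normrM (ger0_norm (condp_ge0 _ _)).
rewrite rsumZ; last first.
  apply: asummable_bounded; first exact: weight_condp.
  exact/bounded_on_norm/bounded2_fiber.
rewrite mulrC ler_wpM2r ?(ltW mx)//; apply: le_trans (ler_norm C).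
rewrite -[leRHS](@wsum_condp_cst k x C mx); apply: ler_wsum.
- exact: weight_condp.
- exact/bounded_on_norm/bounded2_fiber.
- exact: bounded_on_cst.
- by move=> y /condp_gt0 my; exact: h.
Qed.

(** With a single sum over pairs, old and new configuration can be exchanged by reindexing. *)
Lemma bal_pairs k H : bounded2 H -> bal k H =
  rsum (fun p : config Omega * Omega k => m p.1 * (condp mu p.1 p.2 * H p.1 (upd p.1 p.2))).
Proof.
move=> bH; have [_ [s1 <-]] :=
  asummable_rsum (a := fun x (y : Omega k) => m x * (condp mu x y * H x (upd x y))) (asummable_bal k bH).
apply: eq_rsum => x; have [->|mx] := eqVneq (m x) 0.
  by under [RHS]eq_rsum do rewrite mul0r; rewrite rsum0 mul0r.
rewrite rsumZ//; apply: asummable_bounded; first exact: weight_condp.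
by apply: bounded2_fiber => //; rewrite lt_neqAle eq_sym mx m0.
Qed.

(** Detailed balance: the marginal is constant along the fibre, so the weight
    [m x * m (upd x y) / marg k x] is symmetric in the two configurations. The involution [s]
    exchanges them and keeps the old coordinate as the new value. *)
Lemma bal_sym k H : bounded2 H -> bal k H = bal k (fun x x' => H x' x).
Proof.
move=> bH; have bH' : bounded2 (fun x x' => H x' x).
  by have [C h] := bH; exists C => x x' mx mx'; exact: h.
rewrite !bal_pairs//.
pose s (p : config Omega * Omega k) := (upd p.1 p.2, p.1 k).
have sK : cancel s s by move=> [x y]; rewrite /s /= upd_upd upd_id upd_eq.
rewrite (reindex_rsum _ (Bijective sK sK)); apply: eq_rsum => -[x y] /=.
rewrite upd_upd upd_id condp_upd !condpE upd_id.
by move: (marg k x)^-1 => z; ring.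
Qed.

(** Stationarity is reversibility for an [H] that sees only the updated configuration. *)
Lemma wsum_condE k g : bm g -> wsum m (P k g) = wsum m g.
Proof.
move=> bg; have -> : wsum m (P k g) = bal k (fun _ x' => g x') by [].
rewrite bal_sym; last exact: bounded2_r.
by apply: eq_wsum => // x mx; rewrite wsum_condp_cst.
Qed.

Lemma wsum_subr_condE k g h : bm g -> bm h ->
  wsum m (fun x => (g x - P k g x) * h x) = bal k (fun x x' => (g x - g x') * h x).
Proof.
move=> bg bh; apply: eq_wsum => // x mx.
have bc c : bounded_on (@condp R N Omega mu k x) (fun=> c) by exact: bounded_on_cst.
have bf := bounded_fiber k x bg.
rewrite (eq_wsum (h := fun y => g x * h x - h x * g (upd x y))); last 2 first.
- by move=> y; exact: condp_ge0.
- by move=> y _; ring.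
have wk := weight_condp k x.
rewrite wsumB//; last by bounded.
by rewrite (wsumZ (h x))// wsum_condp_cst// condE_wsum; ring.
Qed.

End HeatBathOperators.

Ltac bounded2 := first [ assumption | exact: bounded2_cst | exact: bounded2_bool
  | (apply: bounded2D; bounded2) | (apply: bounded2N; bounded2) | (apply: bounded2M; bounded2)
  | (apply: bounded2_l; bounded) | (apply: bounded2_r; bounded)].

(** * Bounding an off-diagonal term by Dirichlet forms *)

Section Dissipation.
Context {R : realType} {N : nat} {Omega : 'I_N -> pointedType}.
Variable mu : probability (config Omega) R.
Hypothesis countable_Omega : forall k, countable [set: Omega k].
Implicit Types (x : config Omega) (g h : config Omega -> R) (i k : 'I_N).
Implicit Types (H : config Omega -> config Omega -> R).

Local Notation m := (pmass mu).
Local Notation P := (condE mu).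
Local Notation bal := (bal mu).
Let m0 := pmass_ge0 mu.
Let wm := weight_pmass mu countable_Omega.
Let wc k x := weight_condp mu countable_Omega k x.
Let c0 k x (y : Omega k) : 0 <= condp mu x y.
Proof. by case: (wc k x). Qed.

(** By stationarity, resampling [k] before the update at [i] changes nothing. For fixed [x] the sums
    over the resampled [y] and the new value [z] at [i] are exchanged, and the weights
    [condp mu x z] add up to 1. An inequality over updates at [i] can thus be checked with all
    coordinates other than [i] and [k] fixed. *)
Lemma bal_le_fiber i k H (kap : config Omega -> R) : i != k ->
  bounded2 mu H -> bounded_on m kap ->
  (forall x (z : Omega i), 0 < m x ->
    wsum (fun y : Omega k => condp mu x y * condp mu (upd x y) z)
      (fun y => H (upd x y) (upd (upd x z) y)) <= condp mu x z * kap x) ->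
  bal i H <= wsum m kap.
Proof.
move=> ik bH bk hle; pose G x := wsum (@condp R N Omega mu i x) (fun z => H x (upd x z)).
have bG : bounded_on m G by exact: bounded_inner.
have -> : bal i H = wsum m (P k G) by rewrite wsum_condE.
apply: ler_wsum => //; first exact: bounded_condE.
move=> x mx.
pose a (y : Omega k) (z : Omega i) := condp mu x y * (condp mu (upd x y) z * H (upd x y) (upd (upd x y) z)).
have ba y : 0 < condp mu x y -> bounded_on (@condp R N Omega mu i (upd x y)) (fun z => H (upd x y) (upd (upd x y) z)).
  by move=> /condp_gt0 my; exact: bounded2_fiber.
have sa1 y : asummable (a y).
  have [e|cy] := eqVneq (condp mu x y) 0.
    have sw := proj2 (wc i x).
    by apply: asummable_le sw => z; rewrite /a e mul0r normr0.
  apply/asummableZ/asummable_bounded; first exact: wc.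
  by apply: ba; rewrite lt_neqAle eq_sym cy c0.
have sa : asummable (fun p => a p.1 p.2).
  apply: asummable_pair => //; have [C hC] := bH.
  apply: asummable_le (asummableZ C (proj2 (wc k x))) => y.
  rewrite ger0_norm; last by apply: rsum_ge0 => z; exact: normr_ge0.
  have [e|cy] := eqVneq (condp mu x y) 0.
    by rewrite e mulr0; under eq_rsum do rewrite /a e mul0r normr0; rewrite rsum0.
  have {}cy : 0 < condp mu x y by rewrite lt_neqAle eq_sym cy c0.
  rewrite (eq_rsum (b := fun z => condp mu x y *
      (condp mu (upd x y) z * `|H (upd x y) (upd (upd x y) z)|))); last first.
    by move=> z; rewrite normrM ger0_norm ?c0// normrM ger0_norm ?c0.
  rewrite rsumZ; last first.
    by apply: asummable_bounded; [exact: wc|exact/bounded_on_norm/ba].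
  rewrite normrM [`|C| * _]mulrC (ger0_norm (ltW cy)) ler_wpM2l ?(ltW cy)//.
  apply: le_trans (ler_norm C).
  have my := condp_gt0 cy.
  rewrite -[leRHS](@wsum_condp_cst _ _ _ mu countable_Omega i _ C my); apply: ler_wsum.
  - exact: wc.
  - exact/bounded_on_norm/ba.
  - exact: bounded_on_cst.
  - by move=> z /condp_gt0 mz; exact: hC.
have -> : P k G x = rsum (fun y => rsum (a y)).
  apply: eq_rsum => y; have [e|cy] := eqVneq (condp mu x y) 0.
    by rewrite e mul0r -[LHS](@rsum0 R (Omega i)); apply: eq_rsum => z; rewrite /a e mul0r.
  rewrite -rsumZ//; apply: asummable_bounded; first exact: wc.
  by apply: ba; rewrite lt_neqAle eq_sym cy c0.
rewrite rsum_exchange//.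
have bsw : bijective (fun p : Omega i * Omega k => (p.2, p.1)).
  by exists (fun p => (p.2, p.1)) => -[].
have sa' : asummable (fun p : Omega i * Omega k => a p.2 p.1).
  exact: (asummable_reindex bsw sa).
have [sr _] := @asummable_rsum _ _ _ (fun z y => a y z) sa'.
rewrite -[leRHS](@wsum_condp_cst _ _ _ mu countable_Omega i _ (kap x) mx).
apply: le_rsum => //; first by apply: asummable_bounded; [exact: wc|exact: bounded_on_cst].
move=> z; apply: le_trans (hle x z mx).
rewrite le_eqVlt; apply/orP; left; apply/eqP.
by apply: eq_rsum => y; rewrite /a mulrA (upd_comm _ _ _ ik).
Qed.


(** Reversibility gives the expression of [wsum_subr_condE] a mirror image; the two add up to the
    Dirichlet form of the update at [i]. *)
Lemma bal_dirichlet i g h : bounded_on m g -> bounded_on m h ->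
  2 * wsum m (fun x => (g x - P i g x) * h x) =
  bal i (fun x x' => (g x - g x') * (h x - h x')).
Proof.
move=> bg bh; rewrite wsum_subr_condE//.
have b1 : bounded2 mu (fun x x' => (g x - g x') * h x) by bounded2.
have b2 : bounded2 mu (fun x x' => (g x' - g x) * h x') by bounded2.
rewrite [LHS](_ : _ = bal i (fun x x' => (g x - g x') * h x) + bal i (fun x x' => (g x' - g x) * h x')).
  by rewrite -(balD countable_Omega)//; apply: (eq_bal countable_Omega) => x x' _ _; ring.
by rewrite [in X in _ = _ + X]bal_sym//; ring.
Qed.

(** Reversibility maps the updates that increase [F] onto those that decrease it; only ties are left
    out. *)
Lemma bal_half i H (F : config Omega -> R) : bounded2 mu H -> (forall x x', H x x' = H x' x) ->
  2 * bal i (fun x x' => (F x < F x')%R%:R * H x x') =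
  bal i (fun x x' => (F x != F x')%R%:R * H x x').
Proof.
move=> bH Hsym.
have b1 : bounded2 mu (fun x x' => (F x < F x')%R%:R * H x x') by bounded2.
have b2 : bounded2 mu (fun x x' => (F x' < F x)%R%:R * H x x') by bounded2.
rewrite [LHS](_ : _ = bal i (fun x x' => (F x < F x')%R%:R * H x x') +
    bal i (fun x x' => (F x' < F x)%R%:R * H x x')).
  rewrite -(balD countable_Omega _ b1 b2); apply: (eq_bal countable_Omega) => x x' _ _; rewrite -mulrDl; congr (_ * _).
  by case: ltgtP => _; rewrite ?addr0 ?add0r.
have -> : bal i (fun x x' => (F x' < F x)%R%:R * H x x') =
    bal i (fun x x' => (F x < F x')%R%:R * H x x').
  by rewrite (bal_sym countable_Omega _ b2); apply: (eq_bal countable_Omega) => x x' _ _; rewrite Hsym.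
by rewrite mulrDl mul1r.
Qed.

Lemma condp_le1 k x (y : Omega k) : condp mu x y <= 1.
Proof.
have := c0 x y; rewrite le_eqVlt => /orP[/eqP <-//|cy].
have cO := countable_Omega.
rewrite -(rsum_condp cO (condp_gt0_marg cO cy)).
by apply: (ler_term_rsum (a := @condp R N Omega mu k x)); [exact: c0|case: (wc k x)].
Qed.

Lemma weight_condp2 i k x (z : Omega i) :
  weight (fun y : Omega k => condp mu x y * condp mu (upd x y) z).
Proof.
split=> [y|]; first by rewrite mulr_ge0 ?c0.
apply: asummable_le (proj2 (wc k x)) => y.
by rewrite normrM ler_piMr// ger0_norm ?c0// condp_le1.
Qed.

Section Pair.
Variables (a d : 'I_N -> 'I_N -> R) (e M : R).
Hypothesis e0 : 0 < e.
Hypothesis a_ge0 : forall i k, i != k -> 0 <= a i k.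
Hypothesis condp_le : forall i k x (z : Omega i) (y : Omega k), i != k ->
  0 < marg mu k x -> 0 < marg mu k (upd x z) ->
  condp mu x y <= a i k * condp mu (upd x z) y.
Hypothesis condp_osc : forall i k x (z : Omega i) (y w : Omega k), i != k ->
  0 < marg mu k x -> 0 < marg mu k (upd x z) ->
  0 < condp mu (upd x z) y -> 0 < condp mu (upd x z) w ->
  `|condp mu x y / condp mu (upd x z) y - condp mu x w / condp mu (upd x z) w| <= d i k.
Variable g : config Omega -> R.
Hypothesis gb : forall x, 0 < m x -> e <= g x <= M.

(** Covariance of [g] and [ln g] under the conditional law. Subtracting the constant [ln (P k g x)]
    leaves the value unchanged and makes the integrand nonnegative. *)
Definition cov_log k x : R :=
  wsum (@condp R N Omega mu k x)
    (fun y => (g (upd x y) - P k g x) * (ln (g (upd x y)) - ln (P k g x))).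

(** An instance of [pair_ineq]: [b] is the weight of resampling [k] to [y] and then [i] to [z],
    while [q] and [q'] are the conditional laws at [k] before and after the change at [i]. *)
Lemma fiber_pair i k x (z : Omega i) : i != k -> 0 < m x -> P k g x < P k g (upd x z) ->
  let b := fun y : Omega k => condp mu x y * condp mu (upd x y) z in
  let u := fun y : Omega k => g (upd (upd x z) y) in
  let v := fun y : Omega k => g (upd x y) in
  (wsum b (fun y => u y - v y) * (ln (P k g (upd x z)) - ln (P k g x)) <=
  a i k * a k i * wsum b (fun y => (u y - v y) * (ln (u y) - ln (v y))) +
  d i k / 4 * (wsum b (fun y => (u y - v y) * (ln (u y) - ln (v y))) +
    a i k * a k i * condp mu x z * cov_log k x) : Prop).
Proof.
move=> ik mx FF' b u v; have ki : k != i by rewrite eq_sym.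
have cO := countable_Omega.
have Mx j : 0 < marg mu j x by exact: marg_gt0.
have /andP[eF _] := condE_itv cO gb (Mx k).
(* With a vanishing marginal, [P k g (upd x z)] would be the default value 0, which cannot exceed
   [P k g x >= e]. *)
have Mx' : 0 < marg mu k (upd x z).
  rewrite lt_neqAle marg_ge0// andbT eq_sym; apply/eqP => e'.
  move: FF'; rewrite ltNge => /negP; apply; apply: le_trans (ltW (lt_le_trans e0 eF)).
  rewrite condE_wsum /wsum; under eq_rsum do rewrite condpE e' invr0 mulr0 mul0r.
  by rewrite rsum0.
have Mi y : 0 < condp mu x y -> 0 < marg mu i (@upd _ _ x k y).
  by move=> /condp_gt0 my; exact: marg_gt0.
have xz : upd (upd x z) (x i) = x by rewrite upd_upd upd_id.
have xy (y : Omega k) : upd (upd x y) (x k) = x by rewrite upd_upd upd_id.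
have q'q (y : Omega k) : condp mu (upd x z) y <= a i k * condp mu x y.
  by have := @condp_le i k (upd x z) (x i) y ik Mx'; rewrite xz; apply.
have qq' (y : Omega k) : condp mu x y <= a i k * condp mu (upd x z) y by exact: condp_le.
have q0q' (y : Omega k) : 0 < condp mu x y -> 0 < condp mu (@upd _ _ x i z) y.
  by apply: le_weight_gt0 qq' _ => w; exact: c0.
have q'0q (y : Omega k) : 0 < condp mu (@upd _ _ x i z) y -> 0 < condp mu x y.
  by apply: le_weight_gt0 q'q _ => w; exact: c0.
have c1 (y : Omega k) (w : Omega i) : 0 < condp mu x y -> condp mu (@upd _ _ x k y) w <= a k i * @condp _ _ _ mu i x w.
  move=> /Mi my; have := @condp_le k i (upd x y) (x k) w ki my.
  by rewrite xy; apply.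
have c2 (y : Omega k) (w : Omega i) : 0 < condp mu x y -> @condp _ _ _ mu i x w <= a k i * condp mu (@upd _ _ x k y) w.
  by move=> /Mi my; exact: condp_le.
(* The same weight read from the other end: [b y] is the weight of starting at [upd x z], resampling
   [k] to [y] and returning [i] to [x i], times the ratio [M0] of marginals. Hence [b] and [mm]
   times [q'] agree up to the factor [a k i]. *)
pose M0 := marg mu k (upd x z) / marg mu k x.
have M00 : 0 < M0 by rewrite divr_gt0.
pose mm := condp mu x (x i) * M0.
have mx0 : 0 < condp mu x (x i) by rewrite condpE upd_id divr_gt0.
have mm0 : 0 < mm by rewrite mulr_gt0.
have b0 (y : Omega k) : 0 <= b y by rewrite mulr_ge0 ?c0.
have q0 (y : Omega k) : @condp _ _ _ mu k x y = 0 \/ 0 < condp mu x y.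
  by have := c0 x y; rewrite le_eqVlt => /orP[/eqP <-|]; [left|right].
have bE (y : Omega k) : 0 < condp mu x y -> b y = condp mu (upd x z) y * condp mu (upd x y) (x i) * M0.
  move=> qy; have my := Mi y qy; rewrite /b /M0 !condpE.
  have e1 : upd (upd x y) (x i) = upd x y by rewrite -{1}(upd_neq x y ki) upd_id.
  rewrite e1 (upd_comm _ y z ki); field.
  by rewrite !gt_eqF ?Mx.
have wb : weight b.
  split=> //; apply: (@asummable_bounded _ _ _ (fun y => condp mu (upd x y) z)) => //.
  by exists (a k i * condp mu x z) => y /c1 h; rewrite ger0_norm ?c0// h.
have bm (y : Omega k) : b y <= a k i * mm * condp mu (upd x z) y.
  have [qy|qy] := q0 y.
    by rewrite /b qy mul0r mulr_ge0 ?c0// mulr_ge0 ?a_ge0// ltW.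
  rewrite bE// /mm.
  have := ler_wpM2l (mulr_ge0 (c0 (upd x z) y) (ltW M00)) (c1 y (x i) qy).
  lra.
have mb (y : Omega k) : mm * condp mu (upd x z) y <= a k i * b y.
  have := c0 (upd x z) y; rewrite le_eqVlt => /orP[/eqP <-|q'y].
    by rewrite mulr0 mulr_ge0 ?a_ge0.
  have qy := q'0q _ q'y; rewrite bE// /mm.
  have := ler_wpM2l (mulr_ge0 (c0 (upd x z) y) (ltW M00)) (c2 y (x i) qy).
  lra.
have bp (y : Omega k) : b y <= a k i * condp mu x z * condp mu x y.
  have [qy|qy] := q0 y; first by rewrite /b qy mul0r mulr0.
  by rewrite /b mulrC ler_wpM2r ?c0// c1.
have osc (y w : Omega k) : 0 < condp mu x y -> 0 < condp mu x w ->
  `|condp mu (upd x z) y / condp mu x y - condp mu (upd x z) w / condp mu x w| <= d i k.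
  move=> qy qw; have := @condp_osc i k (upd x z) (x i) y w ik Mx'; rewrite xz.
  by apply.
have ub (y : Omega k) : 0 < condp mu x y -> e <= u y <= M by move=> /q0q' /condp_gt0 /gb.
have vb (y : Omega k) : 0 < condp mu x y -> e <= v y <= M by move=> /condp_gt0 /gb.
apply: (pair_ineq e0 wb (wc k x) (wc k (upd x z)) (rsum_condp cO (Mx k)) (rsum_condp cO Mx')
  (a_ge0 ik) (a_ge0 ki) mm0 (c0 x z) bm mb bp q'q qq' osc ub vb FF').
Qed.


Definition dirichlet i : R := wsum m (fun x => (g x - P i g x) * ln (g x)).

Let bg : bounded_on m g. Proof. exact: bounded_on_itv gb. Qed.
Let blg : bounded_on m (fun x => ln (g x)). Proof. exact: bounded_on_ln e0 gb. Qed.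

Lemma condE_itv_supp k x : 0 < m x -> e <= P k g x <= M.
Proof. by move=> mx; apply: condE_itv => //; exact: marg_gt0. Qed.

Let bP k : bounded_on m (P k g). Proof. exact: bounded_on_itv (@condE_itv_supp k). Qed.
Let blP k : bounded_on m (fun x => ln (P k g x)).
Proof. exact: bounded_on_ln e0 (@condE_itv_supp k). Qed.

Lemma dirichletE i : 2 * dirichlet i =
  bal i (fun x x' => (g x - g x') * (ln (g x) - ln (g x'))).
Proof. exact: bal_dirichlet. Qed.

Lemma gt0_supp x : 0 < m x -> 0 < g x.
Proof. by move=> /gb /andP[h _]; exact: lt_le_trans h. Qed.

Lemma dirichlet_ge0 i : 0 <= dirichlet i.
Proof.
rewrite -(pmulr_rge0 _ (ltr0n _ 2)) dirichletE.
apply: wsum_ge0 => // x mx; apply: wsum_ge0 => [y|y /condp_gt0 my]; first exact: c0.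
by apply: lnB_mul_ge0; exact: gt0_supp.
Qed.

Lemma cov_logE k x : 0 < m x ->
  cov_log k x = P k (fun z => (g z - P k g z) * ln (g z)) x.
Proof.
move=> mx; have mk := marg_gt0 countable_Omega k mx.
have bf := bounded_fiber k x bg.
have blf := bounded_fiber k x blg.
have -> : P k (fun z => (g z - P k g z) * ln (g z)) x =
  wsum (@condp R N Omega mu k x) (fun y => (g (upd x y) - P k g x) * ln (g (upd x y))).
  by rewrite condE_wsum; apply: eq_wsum => // y _; rewrite condE_upd.
rewrite /cov_log; have wk := wc k x.
have [FF eF] : exists FF, FF = P k g x by exists (P k g x).
rewrite -eF.
rewrite (eq_wsum (h := fun y => (g (upd x y) - FF) * ln (g (upd x y)) -
   ln FF * (g (upd x y) - FF)))//; last by move=> y _; ring.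
rewrite wsumB//; try bounded.
rewrite (wsumZ (ln FF))//; last bounded.
rewrite [X in ln FF * X]wsumB//; last bounded.
by rewrite wsum_condp_cst// -condE_wsum -eF subrr mulr0 subr0.
Qed.

Lemma wsum_cov_log k : wsum m (cov_log k) = dirichlet k.
Proof.
rewrite (eq_wsum (h := P k (fun z => (g z - P k g z) * ln (g z))))//; last first.
  by move=> x mx; exact: cov_logE.
have bPk := bP k.
by rewrite wsum_condE//; bounded.
Qed.

Lemma bounded_cov_log k : bounded_on m (cov_log k).
Proof.
have bPk := bP k.
have b1 : bounded_on m (fun z => (g z - P k g z) * ln (g z)) by bounded.
have [C hC] := bounded_condE countable_Omega k b1.
by exists C => x mx; rewrite cov_logE// hC.
Qed.

(** Reversibility turns the left side and the Dirichlet form at [i] into sums over updates at [i].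
    Keeping only updates that increase [F = P k g] is exact on the left, where ties contribute 0,
    and discards nonnegative terms from the Dirichlet form. The [cov_log] terms left by [fiber_pair]
    average to the Dirichlet form at [k]. *)
Lemma dirichlet_condE_le i k : i != k -> 0 <= d i k ->
  wsum m (fun x => (g x - P i g x) * ln (P k g x)) <=
  (a i k * a k i + d i k / 4) * dirichlet i +
  d i k / 4 * (a i k * a k i) * dirichlet k.
Proof.
move=> ik d0; have bPk := bP k; have bPi := bP i; have blPk := blP k.
pose F := P k g; set A := a i k * a k i.
pose H1 x x' := (g x - g x') * (ln (F x) - ln (F x')).
pose H2 x x' := (g x - g x') * (ln (g x) - ln (g x')).
have bH1 : bounded2 mu H1 by rewrite /H1; bounded2.
have bH2 : bounded2 mu H2 by rewrite /H2; bounded2.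
have s1 x x' : H1 x x' = H1 x' x by rewrite /H1; ring.
have s2 x x' : H2 x x' = H2 x' x by rewrite /H2; ring.
have e1 : wsum m (fun x => (g x - P i g x) * ln (F x)) =
    bal i (fun x x' => (F x < F x')%R%:R * H1 x x').
  apply: (mulfI (lt0r_neq0 (ltr0n R 2))); rewrite bal_dirichlet//.
  rewrite (bal_half i F bH1 s1); apply: (eq_bal countable_Omega) => x x' _ _; rewrite /H1.
  by case: eqP => [->|_]; rewrite ?mul1r// subrr !mulr0.
have e2 : bal i (fun x x' => (F x < F x')%R%:R * H2 x x') <= dirichlet i.
  have h1 := bal_half i F bH2 s2; have h2 := dirichletE i.
  have : bal i (fun x x' => (F x != F x')%R%:R * H2 x x') <= bal i H2.
    apply: (ler_bal countable_Omega) => //; first by bounded2.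
    move=> x x' mx mx'; rewrite -[leRHS]mul1r; apply: ler_wpM2r; last by case: eqP.
    by apply: lnB_mul_ge0; exact: gt0_supp.
  by rewrite -h1 -[bal i H2]h2 (@ler_pM2l _ 2).
have A0 : 0 <= A by rewrite mulr_ge0 ?a_ge0// eq_sym.
pose c := A + d i k / 4.
have c0' : 0 <= c by rewrite addr_ge0// divr_ge0.
have key : bal i (fun x x' => (F x < F x')%R%:R * H1 x x' - c * ((F x < F x')%R%:R * H2 x x')) <=
    wsum m (fun x => d i k / 4 * A * cov_log k x).
  apply: (bal_le_fiber ik).
  - by bounded2.
  - by apply: bounded_onM; [exact: bounded_on_cst|exact: bounded_cov_log].
  move=> x z mx; rewrite /F.
  have K0 : 0 <= cov_log k x.
    apply: wsum_ge0 => [y|y /condp_gt0 my]; first exact: c0.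
    apply: lnB_mul_ge0; first exact: gt0_supp.
    by have /andP[h _] := condE_itv_supp k mx; exact: lt_le_trans h.
  (* [P k g] ignores coordinate [k], so the indicator is constant along the fibre. *)
  have [FF'|FF'] := ltP (P k g x) (P k g (upd x z)); last first.
    rewrite (eq_wsum (h := fun=> 0)); last 2 first.
    - by move=> y; rewrite mulr_ge0 ?c0.
    - move=> y _; have -> : (P k g (upd x y) < P k g (upd (upd x z) y))%R = false.
        by apply/negbTE; rewrite -leNgt !condE_upd.
      by rewrite !mul0r mulr0 subr0.
    rewrite /wsum; under eq_rsum do rewrite mulr0.
    rewrite rsum0; apply: mulr_ge0; first exact: c0.
    by apply: mulr_ge0 => //; apply: mulr_ge0 => //; exact: divr_ge0.
  have := fiber_pair ik mx FF'.
  have wb := weight_condp2 k x z.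
  have sb y : 0 < condp mu x y * condp mu (@upd _ _ x k y) z ->
      0 < m (upd x y) /\ 0 < m (upd (upd x z) y).
    move=> by0; have [h1 h2] : 0 < condp mu x y /\ 0 < condp mu (upd x y) z.
      by split; rewrite lt_neqAle c0 andbT eq_sym; apply/eqP => h;
        move: by0; rewrite h ?mul0r ?mulr0 ltxx.
    by split; [exact: condp_gt0 h1|rewrite (upd_comm _ _ _ ik); exact: condp_gt0 h2].
  move: wb sb; set b := fun y : Omega k => _ => wb sb.
  have bu : bounded_on b (fun y => g (upd (upd x z) y)).
    by have [C hC] := bg; exists C => y /sb[_ /hC].
  have bv : bounded_on b (fun y => g (upd x y)).
    by have [C hC] := bg; exists C => y /sb[/hC].
  have blu : bounded_on b (fun y => ln (g (upd (upd x z) y))).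
    by have [C hC] := blg; exists C => y /sb[_ /hC].
  have blv : bounded_on b (fun y => ln (g (upd x y))).
    by have [C hC] := blg; exists C => y /sb[/hC].
  rewrite [X in _ -> X <= _](_ : _ = (ln (P k g (upd x z)) - ln (P k g x)) *
      wsum b (fun y => g (upd (upd x z) y) - g (upd x y)) -
      c * wsum b (fun y => (g (upd (upd x z) y) - g (upd x y)) *
         (ln (g (upd (upd x z) y)) - ln (g (upd x y))))); last first.
    rewrite -!wsumZ//; try bounded.
    rewrite -wsumB//; try bounded.
    apply: eq_wsum; first by case: wb.
    move=> y _; have E1 : P k g (upd x y) = P k g x by exact: condE_upd.
    have E2 : P k g (upd (upd x z) y) = P k g (upd x z) by exact: condE_upd.
    have FF2 : (P k g x < P k g (upd x z))%R by [].
    by rewrite /H1 /H2 /F E1 E2 FF2 mulr1n; ring.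
  rewrite -/A /c; lra.
have -> : wsum m (fun x => (g x - P i g x) * ln (P k g x)) =
    bal i (fun x x' => (F x < F x')%R%:R * H1 x x' - c * ((F x < F x')%R%:R * H2 x x')) +
    c * bal i (fun x x' => (F x < F x')%R%:R * H2 x x').
  rewrite -balZ//; last by bounded2.
  rewrite -balD//; try bounded2.
  by rewrite -[LHS]/(wsum m (fun x => (g x - P i g x) * ln (F x))) e1;
    apply: eq_bal => // x x' _ _; ring.
rewrite [X in _ + X <= _]mulrC.
have := ler_wpM2l c0' e2; rewrite wsumZ// in key; last exact: bounded_cov_log.
rewrite wsum_cov_log in key.
move: key; rewrite /c; lra.
Qed.

End Pair.

End Dissipation.

(** * Entropy production along the Euler scheme *)

Section RealArithmetic.
Context {R : realDomainType}.
Implicit Types b c n s w x y : R.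

Lemma gap_summand_le x1 x2 y1 y2 w1 w2 s b :
  x2 <= x1 + s * w1 + b -> y1 + s * w2 <= y2 ->
  x2 - y2 <= (x1 - y1) + s * (w1 - w2) + b.
Proof. lra. Qed.

Lemma gap_total_le x1 x2 y w1 c s b S S' w :
  S' <= S + s * w + b -> s * w <= s * (c * w1) -> c * (x1 + s * w1) <= c * x2 ->
  S' - c * (x2 - y) <= S - c * (x1 - y) + b.
Proof. lra. Qed.

End RealArithmetic.

Section EulerStep.
Context {R : realType} {N : nat} {Omega : 'I_N -> pointedType}.
Variable mu : probability (config Omega) R.
Hypothesis countable_Omega : forall k, countable [set: Omega k].
Implicit Types (x : config Omega) (g h : config Omega -> R) (i k : 'I_N).

Local Notation m := (pmass mu).
Local Notation P := (condE mu).
Local Notation L := (heat_bath_generator mu).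
Let m0 := pmass_ge0 mu.
Let wm := weight_pmass mu countable_Omega.
Let wc k x := weight_condp mu countable_Omega k x.

Let sumr_const_ord (u : R) : \sum_(i < N) u = u *+ N.
Proof. by rewrite sumr_const card_ord. Qed.

Definition xlnx (u : R) : R := u * ln u.

Lemma xlnx_ge_tangent u v : 0 < u -> 0 < v -> xlnx u + (ln u + 1) * (v - u) <= xlnx v.
Proof. by move=> u0 v0; have := mul_lnB_le u0 v0; rewrite /xlnx; lra. Qed.

(** The remainder is quadratic in the increment, which makes the error of an Euler step of order
    [s ^+ 2]. *)
Lemma xlnx_le_tangent u v : 0 < u -> 0 < v ->
  xlnx v <= xlnx u + (ln u + 1) * (v - u) + (v - u) ^+ 2 / u.
Proof.
move=> u0 v0; have := ler_wpM2l (ltW v0) (lnB_le v0 u0).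
rewrite /xlnx (_ : v * (v / u - 1) = v - u + (v - u) ^+ 2 / u); first by lra.
by field; rewrite gt_eqF.
Qed.

(** [h - P k h] has conditional mean zero and [ln (P k g)] is constant along the fibre; in the
    Dirichlet form every summand vanishes. *)
Lemma wsum_subr_condE_inv k h g : bounded_on m h -> bounded_on m (fun x => ln (P k g x)) ->
  wsum m (fun x => (h x - P k h x) * ln (P k g x)) = 0.
Proof.
move=> bh bg; have e : bal mu k (fun x x' => (h x - h x') * (ln (P k g x) - ln (P k g x'))) = 0.
  rewrite -[RHS](@rsum0 R (config Omega)); apply: eq_rsum => x.
  rewrite (_ : wsum _ _ = 0) ?mulr0// -[RHS](@rsum0 R (Omega k)); apply: eq_rsum => y.
  have -> : P k g (upd x y) = P k g x by exact: condE_upd.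
  by rewrite subrr !mulr0.
have := bal_dirichlet countable_Omega k bh bg; rewrite e => /eqP.
by rewrite mulf_eq0 pnatr_eq0 /= => /eqP.
Qed.

Lemma bounded_sum (h : 'I_N -> config Omega -> R) : (forall i, bounded_on m (h i)) ->
  bounded_on m (fun x => \sum_(i < N) h i x).
Proof.
move=> bh; have /choice[C hC] : forall i, exists C, forall x, 0 < m x -> `|h i x| <= C.
  by move=> i; have [C] := bh i; exists C.
exists (\sum_(i < N) C i) => x mx; apply: le_trans (ler_norm_sum _ _ _) _.
by apply: ler_sum => i _; exact: hC.
Qed.

Lemma wsum_sum (h : 'I_N -> config Omega -> R) : (forall i, bounded_on m (h i)) ->
  wsum m (fun x => \sum_(i < N) h i x) = \sum_(i < N) wsum m (h i).
Proof.
move=> bh; have bs (s : seq 'I_N) : bounded_on m (fun x => \sum_(i <- s) h i x) /\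
    wsum m (fun x => \sum_(i <- s) h i x) = \sum_(i <- s) wsum m (h i).
  elim: s => [|i s [b1 e1]].
    split; first by exists 0 => x _; rewrite big_nil normr0.
    rewrite big_nil -[RHS](@rsum0 R (config Omega)); apply: eq_rsum => x.
    by rewrite big_nil mulr0.
  have eq : (fun x => \sum_(j <- i :: s) h j x) = (fun x => h i x + \sum_(j <- s) h j x).
    by apply/funext => x; rewrite big_cons.
  by rewrite eq; split; [exact: bounded_onD|rewrite wsumD// e1 big_cons].
by have [] := bs (index_enum 'I_N).
Qed.

Lemma bounded_generator g : bounded_on m g -> bounded_on m (L g).
Proof.
by move=> bg; apply: bounded_sum => i; apply: bounded_onB => //; exact: bounded_condE.
Qed.

Lemma wsum_generator g : bounded_on m g -> wsum m (L g) = 0.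
Proof.
move=> bg; rewrite wsum_sum => [|i]; last by apply: bounded_onB => //; exact: bounded_condE.
apply: big1 => i _; rewrite wsumB//; last exact: bounded_condE.
by rewrite wsum_condE// subrr.
Qed.

Variables (a d : 'I_N -> 'I_N -> R) (c : R).
Hypothesis a_ge0 : forall i k, i != k -> 0 <= a i k.
Hypothesis aa_ge1 : forall i k, i != k -> 1 <= a i k * a k i.
Hypothesis d_ge0 : forall i k, i != k -> 0 <= d i k.
Hypothesis condp_le : forall i k x (z : Omega i) (y : Omega k), i != k ->
  0 < marg mu k x -> 0 < marg mu k (upd x z) ->
  condp mu x y <= a i k * condp mu (upd x z) y.
Hypothesis condp_osc : forall i k x (z : Omega i) (y w : Omega k), i != k ->
  0 < marg mu k x -> 0 < marg mu k (upd x z) ->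
  0 < condp mu (upd x z) y -> 0 < condp mu (upd x z) w ->
  `|condp mu x y / condp mu (upd x z) y - condp mu x w / condp mu (upd x z) w| <= d i k.
Hypothesis c_ge0 : 0 <= c.
Hypothesis coef : forall i,
  \sum_(k < N | k != i) (a i k * a k i - 1) +
  4^-1 * (\sum_(k < N | k != i) (d k i + d i k) * (a i k * a k i)) <= 1 - c.

Definition xlnx_mean g : R := wsum m (fun x => xlnx (g x)).

(* The functional [Phi] of the introduction. *)
Definition entropy_gap g : R :=
  \sum_(k < N) (xlnx_mean g - xlnx_mean (P k g)) - c * (xlnx_mean g - xlnx (wsum m g)).

Lemma bounded_xlnx e M g : 0 < e -> (forall x, 0 < m x -> e <= g x <= M) ->
  bounded_on m (fun x => xlnx (g x)).
Proof.
by move=> e0 gb; apply: bounded_onM; [exact: bounded_on_itv gb|exact: bounded_on_ln e0 gb].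
Qed.

Lemma xlnx_mean_ge e M g h : 0 < e -> (forall x, 0 < m x -> e <= g x <= M) ->
  (forall x, 0 < m x -> e <= h x <= M) ->
  xlnx_mean g + wsum m (fun x => (ln (g x) + 1) * (h x - g x)) <= xlnx_mean h.
Proof.
move=> e0 gb hb.
have b1 := bounded_xlnx e0 gb; have b2 := bounded_xlnx e0 hb.
have b3 := bounded_on_itv gb; have b4 := bounded_on_ln e0 gb; have b5 := bounded_on_itv hb.
rewrite -wsumD//; last by bounded.
apply: ler_wsum => //; first by bounded.
move=> x mx; have /andP[g1 _] := gb x mx; have /andP[h1 _] := hb x mx.
by apply: xlnx_ge_tangent; [exact: lt_le_trans g1|exact: lt_le_trans h1].
Qed.

Lemma condED k g h x : 0 < m x -> bounded_on m g -> bounded_on m h ->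
  P k (fun z => g z + h z) x = P k g x + P k h x.
Proof. by move=> mx bg bh; rewrite condE_wsum wsumD//; exact: bounded_fiber. Qed.

Lemma condEZ k (s : R) g x : 0 < m x -> bounded_on m g ->
  P k (fun z => s * g z) x = s * P k g x.
Proof. by move=> mx bg; rewrite condE_wsum (wsumZ s)//; exact: bounded_fiber. Qed.

Section Step.
Variables (e M : R).
Hypothesis e0 : 0 < e.
Variable g : config Omega -> R.
Hypothesis gb : forall x, 0 < m x -> e <= g x <= M.

Let bg : bounded_on m g. Proof. exact: bounded_on_itv gb. Qed.
Let blg : bounded_on m (fun x => ln (g x)). Proof. exact: bounded_on_ln e0 gb. Qed.
Let Pb k x : 0 < m x -> e <= P k g x <= M.
Proof. exact: condE_itv_supp. Qed.
Let bP k : bounded_on m (P k g). Proof. exact: bounded_on_itv (@Pb k). Qed.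
Let blP k : bounded_on m (fun x => ln (P k g x)).
Proof. exact: bounded_on_ln e0 (@Pb k). Qed.
Let bL : bounded_on m (L g). Proof. exact: bounded_generator. Qed.

Local Notation D := (dirichlet mu g).

(** Since [a i k * a k i >= 1], the term [d i k / 4] may be multiplied by it. The contribution to
    [D k] is moved to [D i] by exchanging the summation indices, which turns [d i k] into [d k i];
    then [coef] applies to each [D i]. *)
Lemma sum_dirichlet_coef :
  \sum_(i < N) \sum_(k < N | k != i)
    ((a i k * a k i - 1 + d i k / 4) * D i + d i k / 4 * (a i k * a k i) * D k) <=
  (1 - c) * \sum_(i < N) D i.
Proof.
have D0 i : 0 <= D i by exact: (dirichlet_ge0 countable_Omega e0 gb).
pose A i k := a i k * a k i.
apply: (@le_trans _ _ (\sum_(i < N) \sum_(k < N | k != i)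
    ((A i k - 1 + 4^-1 * (d i k * A i k)) * D i + 4^-1 * (d i k * A i k) * D k))).
  apply: ler_sum => i _; apply: ler_sum => k ki; rewrite -/(A i k).
  have ik : i != k by rewrite eq_sym.
  have h := ler_wpM2r (D0 i) (ler_wpM2l (d_ge0 ik) (aa_ge1 ik)).
  by rewrite -/(A i k) in h; lra.
under eq_bigr do rewrite big_split /=.
rewrite big_split /= [X in _ + X](exchange_big_dep xpredT)//=.
have -> : \sum_(j < N) \sum_(i < N | j != i) 4^-1 * (d i j * A i j) * D j =
    \sum_(i < N) \sum_(k < N | k != i) 4^-1 * (d k i * A i k) * D i.
  apply: eq_bigr => i _; apply: eq_big => [k|k _]; first by rewrite eq_sym.
  by rewrite /A [a k i * _]mulrC.
rewrite -big_split /= mulr_sumr; apply: ler_sum => i _.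
rewrite -big_split /=.
rewrite (eq_bigr (fun k => ((A i k - 1) + 4^-1 * ((d k i + d i k) * A i k)) * D i)); last first.
  by move=> k _; ring.
rewrite -mulr_suml; apply: ler_wpM2r => //.
by rewrite big_split /= -mulr_sumr; exact: coef.
Qed.

(** The left side is the derivative along the flow of the sum of conditional entropies, with [P k]
    moved from [L g] onto [ln (P k g)], which it fixes; the right side is [c] times the derivative
    of the entropy. The diagonal terms are exactly [- D i], as [E i i = 0]. *)
Lemma dissipation :
  \sum_(k < N) wsum m (fun x => L g x * (ln (g x) - ln (P k g x))) <=
  c * wsum m (fun x => L g x * ln (g x)).
Proof.
have bgP i : bounded_on m (fun x => P i g x - g x) by have bPi := bP i; bounded.
have eD i : wsum m (fun x => (P i g x - g x) * ln (g x)) = - D i.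
  rewrite -[RHS]mulN1r /dirichlet -wsumZ//; last by have bPi := bP i; bounded.
  by apply: eq_wsum => // x _; ring.
pose E i k := wsum m (fun x => (g x - P i g x) * ln (P k g x)).
have eE i k : wsum m (fun x => (P i g x - g x) * (ln (g x) - ln (P k g x))) = - D i + E i k.
  have bPi := bP i; have blPk := blP k.
  rewrite -eD -wsumD//; try bounded.
  by apply: eq_wsum => // x _; ring.
have -> : wsum m (fun x => L g x * ln (g x)) = - \sum_(i < N) D i.
  rewrite -sumrN; under [in RHS]eq_bigr do rewrite -eD.
  rewrite -wsum_sum => [|i]; last by have bgPi := bgP i; bounded.
  by apply: eq_wsum => // x _; rewrite -mulr_suml.
have -> : \sum_(k < N) wsum m (fun x => L g x * (ln (g x) - ln (P k g x))) =
    \sum_(k < N) \sum_(i < N) (- D i + E i k).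
  apply: eq_bigr => k _; under [in RHS]eq_bigr do rewrite -eE.
  have blPk := blP k.
  rewrite -wsum_sum => [|i]; last by have bgPi := bgP i; bounded.
  by apply: eq_wsum => // x _; rewrite -mulr_suml.
rewrite exchange_big /=.
have E0 i : E i i = 0 by apply: wsum_subr_condE_inv.
have -> : \sum_(i < N) \sum_(k < N) (- D i + E i k) =
    \sum_(i < N) (- D i) + \sum_(i < N) \sum_(k < N | k != i) (- D i + E i k).
  rewrite -big_split /=; apply: eq_bigr => i _.
  by rewrite (bigD1 i)//= E0 addr0.
have h : \sum_(i < N) \sum_(k < N | k != i) (- D i + E i k) <= (1 - c) * \sum_(i < N) D i.
  apply: le_trans sum_dirichlet_coef; apply: ler_sum => i _; apply: ler_sum => k ki.
  have ik : i != k by rewrite eq_sym.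
  have := dirichlet_condE_le countable_Omega e0 a_ge0 condp_le condp_osc gb ik (d_ge0 ik).
  rewrite -/(E i k); move: (E i k) (D i) (D k) (d i k) (a i k) (a k i) => *; lra.
by rewrite sumrN; move: h; lra.
Qed.

Lemma xlnx_mean_condE_le k : xlnx_mean (P k g) <= xlnx_mean g.
Proof.
have bPk := bP k; have blPk := blP k.
have := xlnx_mean_ge e0 (@Pb k) gb.
rewrite (eq_wsum (h := fun x => (g x - P k g x) * ln (P k g x) + (g x - P k g x)))//; last first.
  by move=> x _; ring.
rewrite wsumD//; try bounded.
rewrite [X in _ + (X + _)]wsum_subr_condE_inv// [X in _ + (_ + X)]wsumB//.
by rewrite wsum_condE// subrr !addr0.
Qed.

Let euler s : config Omega -> R := fun x => g x + s * L g x.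

(** For [s * N <= 1] the step is the convex combination [(1 - s N) g + s \sum_i P i g]. *)
Lemma euler_itv s x : 0 <= s -> s * N%:R <= 1 -> 0 < m x -> e <= euler s x <= M.
Proof.
move=> s0 sN mx; rewrite /euler; have /andP[g1 g2] := gb mx.
have L1 : N%:R * (e - g x) <= L g x.
  rewrite mulr_natl -[leLHS]sumr_const_ord; apply: ler_sum => i _.
  by have /andP[h _] := Pb i mx; rewrite lerD2r.
have L2 : L g x <= N%:R * (M - g x).
  rewrite mulr_natl -[leRHS]sumr_const_ord; apply: ler_sum => i _.
  by have /andP[_ h] := Pb i mx; rewrite lerD2r.
have h1 := ler_wpM2l s0 L1; have h2 := ler_wpM2l s0 L2.
have h3 : (s * N%:R) * (g x - e) <= g x - e by rewrite ler_piMl// subr_ge0.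
have h4 : (s * N%:R) * (M - g x) <= M - g x by rewrite ler_piMl// subr_ge0.
by move: h1 h2 h3 h4; move: (L g x) (g x) (N%:R : R) => l y n; lra.
Qed.

Lemma sqr_generator_le x : 0 < m x -> L g x ^+ 2 <= (N%:R * (M - e)) ^+ 2.
Proof.
move=> mx; have /andP[g1 g2] := gb mx.
rewrite -(real_normK (num_real (L g x))) ler_sqr ?nnegrE//; last first.
  by rewrite mulr_ge0// subr_ge0 (le_trans g1).
apply: le_trans (ler_norm_sum _ _ _) _.
rewrite mulr_natl -[leRHS]sumr_const_ord; apply: ler_sum => i _.
have /andP[h1 h2] := Pb i mx; rewrite ler_norml.
by move: h1 h2 g1 g2; move: (P i g x) (g x) => p y; lra.
Qed.

(** Under the sum, [xlnx_mean (euler s)] is bounded above with a quadratic remainder. The terms with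
    a negative sign are bounded below by convexity, which leaves no remainder. The first-order terms
    are those of [dissipation], and the mean is conserved. *)
Lemma entropy_gap_step s : 0 <= s -> s * N%:R <= 1 ->
  entropy_gap (euler s) <= entropy_gap g + s ^+ 2 * (N%:R * ((N%:R * (M - e)) ^+ 2 / e)).
Proof.
move=> s0 sN; have eb x : 0 < m x -> e <= euler s x <= M by exact: euler_itv.
(* A bound on [(L g) ^+ 2 / g], hence on the remainder of [xlnx_le_tangent] divided by [s ^+ 2]. *)
pose B := (N%:R * (M - e)) ^+ 2 / e.
pose W1 := wsum m (fun x => L g x * ln (g x)).
pose W k := wsum m (fun x => L g x * ln (P k g x)).
have bx := bounded_xlnx e0 gb; have bxe := bounded_xlnx e0 eb.
have bc (r : R) : bounded_on m (fun=> r) by exact: bounded_on_cst.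
have wL (h : config Omega -> R) : bounded_on m h ->
    wsum m (fun x => (h x + 1) * (s * L g x)) = s * wsum m (fun x => L g x * h x).
  move=> bh; rewrite (eq_wsum (h := fun x => s * (L g x * h x) + s * L g x))//; last first.
    by move=> x _; ring.
  rewrite wsumD//; try bounded.
  rewrite (wsumZ s)//; last bounded.
  by rewrite (wsumZ s (g := L g))// wsum_generator// mulr0 addr0.
have up : xlnx_mean (euler s) <= xlnx_mean g + s * W1 + s ^+ 2 * B.
  rewrite -(wL (fun x => ln (g x)))//.
  have -> : s ^+ 2 * B = wsum m (fun=> s ^+ 2 * B) by rewrite wsum_cst// rsum_pmass// mulr1.
  rewrite -!wsumD//; try bounded.
  apply: ler_wsum => //; first by bounded.
  move=> x mx; have /andP[g1 _] := gb mx; have /andP[h1 _] := eb x mx.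
  have gx0 := lt_le_trans e0 g1.
  have := xlnx_le_tangent gx0 (lt_le_trans e0 h1).
  rewrite (_ : euler s x - g x = s * L g x); last by rewrite /euler; ring.
  have : (s * L g x) ^+ 2 / g x <= s ^+ 2 * B.
    rewrite exprMn -mulrA; apply: ler_wpM2l; first exact: sqr_ge0.
    apply: ler_pM; [exact: sqr_ge0|by rewrite invr_ge0 ltW|exact: sqr_generator_le|].
    by rewrite lef_pV2 ?posrE.
  move: (xlnx (g x)) (xlnx _) (_ / g x) ((ln _ + 1) * _) (s ^+ 2 * B) => *; lra.
have lo : xlnx_mean g + s * W1 <= xlnx_mean (euler s).
  have := xlnx_mean_ge e0 gb eb; rewrite -(wL (fun x => ln (g x)))//.
  by congr (_ + _ <= _); apply: eq_wsum => // x _; rewrite /euler; congr (_ * _); ring.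
have loP k : xlnx_mean (P k g) + s * W k <= xlnx_mean (P k (euler s)).
  have blPk := blP k; have bPk := bP k; have bPL := bounded_condE countable_Omega k bL.
  have be : bounded_on m (fun x => s * L g x) by bounded.
  have := xlnx_mean_ge e0 (@Pb k) (fun x mx => condE_itv countable_Omega eb (marg_gt0 countable_Omega k mx)).
  congr (_ + _ <= _).
  rewrite (eq_wsum (h := fun x => s * P k (L g) x + (- s) * ((L g x - P k (L g) x) * ln (P k g x)) +
     s * (L g x * ln (P k g x))))//; last first.
    by move=> x mx; rewrite condED// condEZ//; ring.
  rewrite wsumD//; try bounded.
  rewrite wsumD//; try bounded.
  rewrite (wsumZ s (g := P k (L g)))// wsum_condE// wsum_generator// mulr0 add0r.
  rewrite (wsumZ (- s))//; last bounded.
  rewrite wsum_subr_condE_inv// mulr0 add0r (wsumZ s)//; bounded.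
have We : wsum m (euler s) = wsum m g.
  by rewrite wsumD ?wsumZ ?wsum_generator ?mulr0 ?addr0//; bounded.
have dis : \sum_(k < N) (W1 - W k) <= c * W1.
  apply: le_trans dissipation; rewrite le_eqVlt; apply/orP; left; apply/eqP.
  apply: eq_bigr => k _; have blPk := blP k.
  rewrite -wsumB//; try bounded.
  by apply: eq_wsum => // x _; ring.
have hs : \sum_(k < N) (xlnx_mean (euler s) - xlnx_mean (P k (euler s))) <=
    \sum_(k < N) (xlnx_mean g - xlnx_mean (P k g)) + s * (\sum_(k < N) (W1 - W k)) +
      s ^+ 2 * (N%:R * B).
  rewrite mulr_natl -sumr_const_ord mulr_sumr mulr_sumr -!big_split /=.
  by apply: ler_sum => k _; exact: gap_summand_le up (loP k).
rewrite /entropy_gap We -/B.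
exact: gap_total_le hs (ler_wpM2l s0 dis) (ler_wpM2l c_ge0 lo).
Qed.

End Step.

End EulerStep.

(** * Convergence of the Euler scheme *)

Section ExpApprox.
Context {R : realType}.

Lemma bin_ffact_le n j : ('C(n, j) * j`! <= n ^ j)%N.
Proof.
rewrite bin_ffact; elim: j => [|j ih]; first by rewrite ffactn0 expn0.
by rewrite ffactnSr expnSr leq_mul// leq_subr.
Qed.

(** The power is [exp (p ln (1 + y / p))] with [p = n + 1]. The exponent is at least
    [y - y ^+ 2 / p], and [exp (- z) >= 1 - z] does the rest. *)
Lemma exp_powern_le (y : R) n : 0 <= y -> expR y - (1 + y / n.+1%:R) ^+ n.+1 <= expR y * (y ^+ 2 / n.+1%:R).
Proof.
move=> y0; set p : R := n.+1%:R; have p0 : 0 < p by rewrite ltr0n.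
have u0 : 0 <= y / p by rewrite divr_ge0// ltW.
have v0 : 0 < 1 + y / p by rewrite ltr_pwDl.
have ly : p * ln (1 + y / p) >= y - y ^+ 2 / p.
  have := lnB_le ltr01 v0; rewrite ln1 => h.
  have {}h : 1 - (1 + y / p)^-1 <= ln (1 + y / p) by lra.
  have := ler_wpM2l (ltW p0) h; apply: le_trans.
  have -> : p * (1 - (1 + y / p)^-1) = y - y ^+ 2 / (p + y).
    by field; rewrite !gt_eqF// ltr_wpDr.
  by rewrite lerD2l lerN2 ler_wpM2l ?sqr_ge0// lef_pV2 ?posrE ?lerDl// ltr_wpDr.
have -> : (1 + y / p) ^+ n.+1 = expR (p * ln (1 + y / p)).
  by rewrite (mulr_natl (ln (1 + y / p)) n.+1) -lnXn// lnK// posrE exprn_gt0.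
have h : expR (y - y ^+ 2 / p) <= expR (p * ln (1 + y / p)) by rewrite ler_expR.
have h2 := expR_ge1Dx (- (y ^+ 2 / p)).
have := ler_wpM2l (expR_ge0 y) h2; rewrite -expRD => h3.
move: h h3; set A := expR y; set B := expR (y - _); set D := expR (_ * _).
by move: (y ^+ 2 / p) => z; lra.
Qed.

Lemma cvg_inv_cst (C : R) : (C / n.+1%:R) @[n --> \oo] --> 0.
Proof.
rewrite -[0](mulr0 C); apply: cvgM; first exact: cvg_cst.
exact: cvg_harmonic.
Qed.

(* Binomial sums approximate the exponential series: the coefficient
   ['C(n, j) / n ^ j] never exceeds [1 / j!], so the error is dominated by that
   of the compound interest formula. *)
Lemma binomial_exp_approx (a : nat -> R) (K B t : R) n : 0 <= K -> 0 <= B -> 0 <= t ->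
  (forall j, `|a j| <= K * B ^+ j) ->
  `|limn (series (fun j => exp_coeff t j * a j)) -
    \sum_(j < n.+2) 'C(n.+1, j)%:R * (t / n.+1%:R) ^+ j * a j| <=
  K * (expR (t * B) * ((t * B) ^+ 2 / n.+1%:R)).
Proof.
move=> K0 B0 t0 ha; have y0 : 0 <= t * B by rewrite mulr_ge0.
set E := \sum_(j < n.+2) _; set C := K * _; set p : R := n.+1%:R.
have p0 : 0 < p by rewrite ltr0n.
pose u j := exp_coeff t j * a j.
have un j : `|u j| <= K * exp_coeff (t * B) j.
  rewrite /u /exp_coeff /= normrM ger0_norm ?divr_ge0 ?exprn_ge0//.
  apply: le_trans (ler_wpM2l _ (ha j)) _; first by rewrite divr_ge0 ?exprn_ge0.
  by rewrite exprMn le_eqVlt; apply/orP; left; apply/eqP; ring.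
have cu : cvgn (series u).
  apply: normed_cvg; apply: (series_le_cvg (v_ := fun j => K * exp_coeff (t * B) j)).
  - by move=> j; exact: normr_ge0.
  - by move=> j; rewrite mulr_ge0// exp_coeff_ge0.
  - exact: un.
  - exact/is_cvg_seriesZ/is_cvg_series_exp_coeff.
pose r j : R := 'C(n.+1, j)%:R * p ^- j.
have r0 j : 0 <= r j by rewrite mulr_ge0// invr_ge0 exprn_ge0// ltW.
have rle j : r j <= (j`!%:R)^-1.
  rewrite /r ler_pdivrMr ?exprn_gt0// mulrC ler_pdivlMr ?ltr0n ?fact_gt0//.
  by rewrite -natrX -natrM ler_nat bin_ffact_le.
(* Past [n.+1] the binomial coefficients vanish, so the finite sum extends to the range of any later
   partial sum of the series and is compared with it term by term. *)
have EE q : (n.+2 <= q)%N -> E = \sum_(0 <= j < q) r j * t ^+ j * a j.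
  move=> nq; rewrite (big_cat_nat (n := n.+2))//= [X in _ = _ + X]big1_seq ?addr0.
    rewrite big_mkord; apply: eq_bigr => j _.
    by rewrite /r expr_div_n; congr (_ * _); rewrite mulrAC mulrA.
  move=> j; rewrite mem_index_iota => /andP[_ /andP[nj _]].
  by rewrite /r bin_small// !mul0r.
have pw : (1 + t * B / p) ^+ n.+1 = \sum_(j < n.+2) r j * (t * B) ^+ j.
  rewrite exprDn; apply: eq_bigr => j _.
  by rewrite expr1n mul1r expr_div_n /r -mulr_natl; ring.
have pwE q : (n.+2 <= q)%N -> (1 + t * B / p) ^+ n.+1 = \sum_(0 <= j < q) r j * (t * B) ^+ j.
  move=> nq; rewrite pw (big_cat_nat (n := n.+2))//= [X in _ = _ + X]big1_seq ?addr0.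
    by rewrite big_mkord.
  move=> j; rewrite mem_index_iota => /andP[_ /andP[nj _]].
  by rewrite /r bin_small// !mul0r.
have key q : (n.+2 <= q)%N -> `|series u q - E| <= C.
  move=> nq; rewrite (EE q nq) /series /= -sumrB.
  apply: le_trans (ler_norm_sum _ _ _) _.
  apply: (@le_trans _ _ (K * (series (exp_coeff (t * B)) q - (1 + t * B / p) ^+ n.+1))).
    rewrite (pwE q nq) /series /= -sumrB mulr_sumr; apply: ler_sum => j _.
    have -> : u j - r j * t ^+ j * a j = ((j`!%:R)^-1 - r j) * t ^+ j * a j.
      by rewrite /u /exp_coeff /=; ring.
    rewrite normrM ger0_norm; last by rewrite mulr_ge0 ?exprn_ge0// subr_ge0.
    apply: le_trans (ler_wpM2l _ (ha j)) _.
      by rewrite mulr_ge0 ?exprn_ge0// subr_ge0.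
    by rewrite /exp_coeff /= exprMn le_eqVlt; apply/orP; left; apply/eqP; ring.
  rewrite /C ler_wpM2l//; apply: le_trans (exp_powern_le n y0).
  rewrite lerD2r; apply: nondecreasing_cvgn_le; last exact: is_cvg_series_exp_coeff.
  by apply: nondecreasing_series => j _ _; exact: exp_coeff_ge0.
have cd : (`|series u q - E|) @[q --> \oo] --> `|limn (series u) - E|.
  by apply: cvg_norm; apply: cvgB => //; exact: cvg_cst.
have /(cvg_lim (@Rhausdorff R)) <- := cd.
apply: limr_le; first by apply/cvg_ex; eexists; exact: cd.
by near=> q; apply: key; near: q; exact: nbhs_infty_ge.
Unshelve. all: by end_near. Qed.

End ExpApprox.

(** * The Euler scheme converges to the heat bath semigroup *)

Section HeatBathApprox.
Context {R : realType} {N : nat} {Omega : 'I_N -> pointedType}.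
Variable mu : probability (config Omega) R.
Hypothesis countable_Omega : forall k, countable [set: Omega k].
Implicit Types (x : config Omega) (g h : config Omega -> R) (i k : 'I_N).

Local Notation m := (pmass mu).
Local Notation P := (condE mu).
Local Notation L := (heat_bath_generator mu).
Let m0 := pmass_ge0 mu.
Let wm := weight_pmass mu countable_Omega.

Definition euler_step (s : R) g : config Omega -> R := fun x => g x + s * L g x.

Lemma eq_condE_supp k g h x : (forall z, 0 < m z -> g z = h z) -> P k g x = P k h x.
Proof.
move=> gh; apply: eq_wsum => [y|y /condp_gt0 my]; last exact: gh.
by case: (weight_condp mu countable_Omega k x).
Qed.

Lemma eq_generator_supp g h x : (forall z, 0 < m z -> g z = h z) -> 0 < m x -> L g x = L h x.
Proof.
by move=> gh mx; apply: eq_bigr => i _; rewrite (eq_condE_supp _ _ gh) gh.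
Qed.

Lemma generatorD g h x : bounded_on m g -> bounded_on m h -> 0 < m x ->
  L (fun z => g z + h z) x = L g x + L h x.
Proof.
move=> bg bh mx; rewrite /heat_bath_generator -big_split /=; apply: eq_bigr => i _.
by rewrite condED//; ring.
Qed.

Lemma generatorZ (s : R) g x : bounded_on m g -> 0 < m x -> L (fun z => s * g z) x = s * L g x.
Proof.
move=> bg mx; rewrite /heat_bath_generator mulr_sumr; apply: eq_bigr => i _.
by rewrite condEZ//; ring.
Qed.

Lemma generator_sum n (s : nat -> R) (h : nat -> config Omega -> R) x :
  (forall j, bounded_on m (h j)) -> 0 < m x ->
  L (fun z => \sum_(j < n) s j * h j z) x = \sum_(j < n) s j * L (h j) x.
Proof.
move=> bh mx; elim: n => [|n ih].
  rewrite big_ord0 /heat_bath_generator big1// => i _.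
  rewrite big_ord0 condE_wsum (@eq_wsum _ _ _ _ (fun=> 0)).
  - by rewrite wsum_condp_cst// subrr.
  - by case: (weight_condp mu countable_Omega i x).
  - by move=> y _; rewrite big_ord0.
have bs p : bounded_on m (fun z => \sum_(j < p) s j * h j z).
  elim: p => [|p bp]; first by exists 0 => z _; rewrite big_ord0 normr0.
  have bhp := bh p; have b1 : bounded_on m (fun z => (\sum_(j < p) s j * h j z) + s p * h p z) by bounded.
  by have [C hC] := b1; exists C => z /hC; rewrite big_ord_recr.
have bhn := bh n; have b1 := bs n.
rewrite big_ord_recr /= -ih -generatorZ// -generatorD//; last by bounded.
by apply: eq_generator_supp => // z _; rewrite big_ord_recr.
Qed.

Variables (f : config Omega -> R) (M : R).
Hypothesis fM : forall x, 0 < m x -> `|f x| <= M.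

(** Each [P i - 1] has norm at most 2 for the supremum over points of positive mass, so [L] has norm
    at most [2 N]. *)
Lemma iter_generator_le j x : 0 < m x -> `|iter j L f x| <= M * (N%:R *+ 2) ^+ j.
Proof.
elim: j x => [|j ih] x mx; first by rewrite expr0 mulr1 fM.
rewrite iterS; set h := iter j L f in ih *; set C := M * _ in ih *.
have hb z : 0 < m z -> - C <= h z <= C by move=> /ih; rewrite ler_norml.
apply: le_trans (ler_norm_sum _ _ _) _.
rewrite exprSr mulrA -/C mulrnAr mulrC mulr_natl -mulrnA mulnC mulrnA.
have <- : \sum_(i < N) (C *+ 2) = C *+ 2 *+ N by rewrite sumr_const card_ord.
apply: ler_sum => i _; rewrite mulr2n; apply: le_trans (ler_normB _ _) _.
apply: lerD; last exact: ih.
by rewrite ler_norml; apply: condE_itv => //; exact: marg_gt0.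
Qed.

Lemma bounded_iter_generator j : bounded_on m (iter j L f).
Proof. by exists (M * (N%:R *+ 2) ^+ j) => x; exact: iter_generator_le. Qed.

Lemma iter_euler n s x : 0 < m x ->
  iter n (euler_step s) f x = \sum_(j < n.+1) 'C(n, j)%:R * s ^+ j * iter j L f x.
Proof.
elim: n x => [|n ih] x mx.
  by rewrite big_ord_recr big_ord0 /= bin0 expr0 !mul1r add0r.
rewrite iterS /euler_step (eq_generator_supp ih)// ih//.
rewrite (@generator_sum n.+1 (fun j => 'C(n, j)%:R * s ^+ j) (fun j => iter j L f))//; last first.
  exact: bounded_iter_generator.
rewrite [RHS]big_ord_recl /= big_ord_recl /= !bin0 expr0 !mul1r -addrA; congr (_ + _).
have -> : \sum_(i < n.+1) 'C(n.+1, bump 0 i)%:R * s ^+ bump 0 i * iter (bump 0 i) L f x =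
   \sum_(i < n.+1) ('C(n, i.+1)%:R * s ^+ i.+1 * iter i.+1 L f x +
     s * ('C(n, i)%:R * s ^+ i * iter i.+1 L f x)).
  by apply: eq_bigr => i _; rewrite /bump /= add1n binS natrD exprS; ring.
rewrite big_split /= -mulr_sumr; congr (_ + _).
by rewrite big_ord_recr /= bin_small// !mul0r addr0.
Qed.

Lemma heat_bath_approx (t : R) n x : 0 <= t -> 0 < m x ->
  `|heat_bath mu t f x - iter n.+1 (euler_step (t / n.+1%:R)) f x| <=
  M * (expR (t * (N%:R *+ 2)) * ((t * (N%:R *+ 2)) ^+ 2)) / n.+1%:R.
Proof.
move=> t0 mx; rewrite iter_euler//.
have M0 : 0 <= M by apply: le_trans (fM mx).
have := @binomial_exp_approx R (fun j => iter j L f x) M (N%:R *+ 2) t n M0 _ t0 _.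
rewrite !mulrA; apply; first by rewrite mulrn_wge0.
by move=> j; exact: iter_generator_le.
Qed.

Lemma cvg_iter_euler (t : R) x : 0 <= t -> 0 < m x ->
  iter n.+1 (euler_step (t / n.+1%:R)) f x @[n --> \oo] --> heat_bath mu t f x.
Proof.
move=> t0 mx; apply/cvgrPdist_le => eps eps0.
set C := M * (expR (t * (N%:R *+ 2)) * ((t * (N%:R *+ 2)) ^+ 2)).
have := cvg_inv_cst C => /cvgrPdist_le /(_ _ eps0).
apply: filterS => n; rewrite sub0r normrN => h.
apply: le_trans (heat_bath_approx n t0 mx) _; exact: le_trans (ler_norm _) h.
Qed.

End HeatBathApprox.

(** * Dominated convergence and continuity of [u ln u] *)

Section Limits.
Context {R : realType} {N : nat} {Omega : 'I_N -> pointedType}.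
Variable mu : probability (config Omega) R.
Hypothesis countable_Omega : forall k, countable [set: Omega k].
Local Notation m := (pmass mu).

Lemma cvg_wsum (h_ : nat -> config Omega -> R) (h : config Omega -> R) C :
  (forall n x, 0 < m x -> `|h_ n x| <= C) ->
  (forall x, 0 < m x -> h_ n x @[n --> \oo] --> h x) ->
  wsum m (h_ n) @[n --> \oo] --> wsum m h.
Proof.
move=> hC hh; have m0 := pmass_ge0 mu.
(* Extending by 0 off the support makes bounds and convergence hold everywhere, without changing the
   sums. *)
pose tr (g : config Omega -> R) x := if 0 < m x then g x else 0.
have trE g : wsum m (tr g) = wsum m g by apply: eq_wsum => // x mx; rewrite /tr mx.
have trh x : tr (h_ n) x @[n --> \oo] --> tr h x.
  by rewrite /tr; case: ifP => mx; [exact: hh|exact: cvg_cst].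
have trC n x : `|tr (h_ n) x| <= `|C|.
  rewrite /tr; case: ifP => mx; last by rewrite normr0.
  by apply: le_trans (hC _ _ mx) (ler_norm _).
have trb x : `|tr h x| <= `|C|.
  have cn : `|tr (h_ n) x| @[n --> \oo] --> `|tr h x| by apply: cvg_norm.
  have /(cvg_lim (@Rhausdorff R)) <- := cn.
  by apply: limr_le; [apply/cvg_ex; eexists; exact: cn|apply: nearW].
have [||||| _ _] := @dominated_convergence _ _ R mu setT measurableT
  (fun n => EFin \o tr (h_ n)) (EFin \o tr h) (EFin \o cst `|C|).
- by move=> n _ A _.
- by move=> _ A _.
- by apply: aeW => x _; apply/cvg_EFin; [exact: nearW|exact: trh].
- exact: finite_measure_integrable_cst.
- by apply: aeW => x n _; rewrite /= lee_fin.
have bt g D : (forall x, `|tr g x| <= D) -> bounded_on m (tr g) by exists D.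
have fin g D : (forall x, `|tr g x| <= D) -> (\int[mu]_x (tr g x)%:E)%E \is a fin_num.
  move=> gD; apply: integrable_fin_num => //.
  apply: measurable_bounded_integrable; [by []|exact: fin_num_fun_lty|by move=> _ A _|].
  by exists D; split; [exact: num_real|move=> y yD x _; apply: le_trans (gD x) (ltW yD)].
have int g D : (forall x, `|tr g x| <= D) -> fine (\int[mu]_x (tr g x)%:E)%E = wsum m g.
  by move=> gD; rewrite -trE -Rintegral_config//; exact: bt gD.
move=> hc; rewrite -(int h _ trb).
have -> : (fun n => wsum m (h_ n)) = (fun n => fine (\int[mu]_x (tr (h_ n) x)%:E)%E).
  by apply/funext => n; rewrite (int _ _ (trC n)).
by apply: fine_cvg; rewrite fineK ?(fin _ _ trb).
Qed.

(** Only the limit 0 is delicate. There [|u ln u| <= 2 sqrt u] for [u <= 1], because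
    [u ln u = 2 v (v ln v)] with [v = sqrt u], and [- v ln v <= 1]. *)
Lemma cvg_xlnx (u : nat -> R) (l : R) : (forall n, 0 <= u n) -> u n @[n --> \oo] --> l ->
  xlnx (u n) @[n --> \oo] --> xlnx l.
Proof.
move=> u0 ul.
have l0 : 0 <= l.
  have /(cvg_lim (@Rhausdorff R)) <- := ul.
  by apply: limr_ge; [apply/cvg_ex; eexists; exact: ul|apply: nearW].
have [ll|ll] := eqVneq l 0; last first.
  apply: cvgM => //; apply: continuous_cvg => //.
  by apply: continuous_ln; rewrite lt_neqAle eq_sym ll.
rewrite ll in ul *; rewrite /xlnx mul0r.
have su : 2 * Num.sqrt (u n) @[n --> \oo] --> 0.
  rewrite -[0](mulr0 2) -[X in 2 * X](@sqrtr0 R); apply: cvgM; first exact: cvg_cst.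
  by apply: continuous_cvg => //; exact: sqrt_continuous.
apply/cvgrPdist_le => eps eps0.
move/cvgrPdist_le : su => /(_ eps eps0); move/cvgrPdist_le : ul => /(_ 1 ltr01).
apply: filterS2 => n; rewrite !sub0r !normrN => un1 sn.
apply: le_trans sn; apply: le_trans (ler_norm _).
have := u0 n; rewrite le_eqVlt => /orP[/eqP <-|un].
  by rewrite mul0r normr0 sqrtr0 mulr0.
have s0 : 0 < Num.sqrt (u n) by rewrite sqrtr_gt0.
have e : u n = Num.sqrt (u n) ^+ 2 by rewrite sqr_sqrtr.
have lnE : ln (u n) = ln (Num.sqrt (u n)) *+ 2 by rewrite {1}e lnXn.
have ule : u n <= 1 by apply: le_trans un1; rewrite ger0_norm.
rewrite normrM ger0_norm// ler0_norm ?ln_le0//.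
rewrite lnE {1}e; set v := Num.sqrt (u n) in s0 *.
have := mul_lnB_le ltr01 s0; rewrite ln1 => h.
have {}h : v * (- ln v) <= 1 by lra.
have := ler_wpM2l (ltW s0) h; lra.
Qed.

End Limits.

(** * Finiteness of the coefficients *)

Section Coefficients.
Context {R : realType} {N : nat} {Omega : 'I_N -> pointedType}.
Variable mu : probability (config Omega) R.
Hypothesis countable_Omega : forall k, countable [set: Omega k].
Local Notation m := (pmass mu).
Implicit Types (x : config Omega) (i k : 'I_N).

Lemma exists_pmass_gt0 : exists x, 0 < m x.
Proof.
apply/not_existsP => h; have := rsum_pmass mu countable_Omega.
rewrite (_ : rsum m = 0) => [/eqP|]; first by rewrite eq_sym oner_eq0.
rewrite -[RHS](@rsum0 R (config Omega)); apply: eq_rsum => x; apply/eqP.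
by rewrite eq_le pmass_ge0 andbT leNgt; apply/negP/h.
Qed.

Let c0 k x (y : Omega k) : 0 <= condp mu x y.
Proof. by case: (weight_condp mu countable_Omega k x). Qed.

Lemma phiE i k x (z : Omega i) (y : Omega k) : 0 < condp mu (upd x z) y ->
  phi mu x z y = (condp mu x y / condp mu (upd x z) y)%:E.
Proof. by move=> c; rewrite /phi inver gt_eqF. Qed.

(** The trivial replacement [y_i = x_i] at a point of positive mass. It shows that the suprema
    defining [alpha] and [delta] run over nonempty sets, hence are at least 1 and 0. *)
Lemma phi_id i k x : 0 < m x ->
  phi_dom mu x (x i) (x k) /\ phi mu x (x i) (x k) = 1%E.
Proof.
move=> mx; have ck : 0 < condp mu x (x k).
  by rewrite condpE upd_id divr_gt0// marg_gt0.
split; last by rewrite phiE upd_id// divff// gt_eqF.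
by split; rewrite ?upd_id ?marg_gt0E ?marg_gt0//; left.
Qed.

Lemma alpha_ge1 i k : (1 <= alpha mu i k)%E.
Proof.
have [x mx] := exists_pmass_gt0; have [dx e] := phi_id i k mx.
by apply: ereal_sup_ubound; exists x, (x i), (x k); rewrite e.
Qed.

Lemma delta_ge0 i k : (0 <= delta mu i k)%E.
Proof.
have [x mx] := exists_pmass_gt0; have [dx e] := phi_id i k mx.
by apply: ereal_sup_ubound; exists x, (x i), (x k), (x k); rewrite e subee// abse0.
Qed.

Hypothesis gamma_kappa : (gamma mu + kappa mu < 1)%E.

Let gterm i := (\sum_(k < N | k != i) `|alpha mu i k * alpha mu k i - 1|)%E.
Let kterm i := (\sum_(k < N | k != i) (delta mu k i + delta mu i k) * (alpha mu i k * alpha mu k i))%E.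

Lemma alphaM_ge1 i k : (1 <= alpha mu i k * alpha mu k i)%E.
Proof. by rewrite -[leLHS]mule1; apply: lee_pmul => //; exact: alpha_ge1. Qed.

Lemma gterm_le i : (gterm i <= gamma mu)%E.
Proof. exact: (le_bigmax _ gterm). Qed.

Lemma gamma_ge0 : (0 <= gamma mu)%E. Proof. exact: bigmax_ge_id. Qed.

Lemma kterm_ge0 i : (0 <= kterm i)%E.
Proof.
apply: sume_ge0 => k _; apply: mule_ge0; first by rewrite adde_ge0// delta_ge0.
by apply: le_trans (alphaM_ge1 i k).
Qed.

Lemma kterm_le i : ((4^-1)%:E * kterm i <= kappa mu)%E.
Proof. by apply: lee_wpmul2l; [rewrite lee_fin|exact: (le_bigmax _ kterm)]. Qed.

Lemma kappa_ge0 : (0 <= kappa mu)%E.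
Proof. by apply: mule_ge0; [rewrite lee_fin|exact: bigmax_ge_id]. Qed.

Lemma gamma_fin : gamma mu \is a fin_num.
Proof.
rewrite ge0_fin_numE ?gamma_ge0//; apply: le_lt_trans (lt_trans gamma_kappa (ltry 1)).
by rewrite leeDl// kappa_ge0.
Qed.

Lemma kappa_fin : kappa mu \is a fin_num.
Proof.
rewrite ge0_fin_numE ?kappa_ge0//; apply: le_lt_trans (lt_trans gamma_kappa (ltry 1)).
by rewrite leeDr// gamma_ge0.
Qed.

Lemma alphaM_fin i k : k != i -> (alpha mu i k * alpha mu k i)%E \is a fin_num.
Proof.
move=> ki; rewrite ge0_fin_numE; last by apply: le_trans (alphaM_ge1 i k).
have h : (`|alpha mu i k * alpha mu k i - 1| <= gamma mu)%E.
  apply: le_trans (gterm_le i); rewrite /gterm (bigD1 k)//=.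
  by rewrite leeDl// sume_ge0.
have : (alpha mu i k * alpha mu k i - 1 < +oo)%E.
  apply: le_lt_trans (lee_abs _) _; apply: le_lt_trans h _.
  by rewrite -ge0_fin_numE ?gamma_fin ?gamma_ge0.
by case: (alpha mu i k * alpha mu k i)%E => //= r _; exact: ltry.
Qed.

(** The other factor [alpha k i] is at least 1, so [alpha i k] is below the product, which [gamma]
    keeps finite. *)
Lemma alpha_fin i k : k != i -> alpha mu i k \is a fin_num.
Proof.
move=> ki; have a1 := alpha_ge1 i k; have a2 := alpha_ge1 k i.
rewrite ge0_fin_numE; last by apply: le_trans a1.
have := alphaM_fin ki; rewrite ge0_fin_numE; last by apply: le_trans (alphaM_ge1 i k).
apply: le_lt_trans; rewrite -[leLHS]mule1; apply: lee_pmul => //.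
by apply: le_trans a1.
Qed.

(** In [kappa] it is multiplied by a product of [alpha] that is at least 1, so it lies below a
    finite summand. *)
Lemma delta_fin i k : k != i -> delta mu i k \is a fin_num.
Proof.
move=> ki; rewrite ge0_fin_numE ?delta_ge0//.
have kl : (kterm i < +oo)%E.
  have := le_lt_trans (kterm_le i) (_ : kappa mu < +oo)%E.
  rewrite -ge0_fin_numE ?kappa_ge0// kappa_fin => /(_ isT).
  case: (kterm i) (kterm_ge0 i) => //= [r _ _|_]; first exact: ltry.
  by rewrite gt0_muley ?lte_fin ?invr_gt0.
apply: le_lt_trans kl; rewrite /kterm (bigD1 k)//=.
apply: (@le_trans _ _ ((delta mu k i + delta mu i k) * (alpha mu i k * alpha mu k i))%E).
  rewrite -[leLHS]mule1; apply: lee_pmul => //; rewrite ?delta_ge0 ?alphaM_ge1//.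
  by rewrite leeDr// delta_ge0.
rewrite leeDl// sume_ge0// => j _; apply: mule_ge0; first by rewrite adde_ge0// delta_ge0.
by apply: le_trans (alphaM_ge1 i j).
Qed.

Definition ralpha i k : R := fine (alpha mu i k).
Definition rdelta i k : R := fine (delta mu i k).

Lemma ralpha_ge1 i k : i != k -> 1 <= ralpha i k.
Proof. by move=> ik; rewrite -lee_fin fineK ?alpha_ge1// alpha_fin// eq_sym. Qed.

Lemma ralphaM_ge1 i k : i != k -> 1 <= ralpha i k * ralpha k i.
Proof.
move=> ik; have ki : k != i by rewrite eq_sym.
have h1 := ralpha_ge1 ik; have h2 := ralpha_ge1 ki.
by rewrite -[leLHS]mul1r ler_pM.
Qed.

Lemma rdelta_ge0 i k : 0 <= rdelta i k.
Proof. by rewrite fine_ge0// delta_ge0. Qed.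

Lemma condp_le_ralpha i k x (z : Omega i) (y : Omega k) : i != k ->
  0 < marg mu k x -> 0 < marg mu k (upd x z) ->
  condp mu x y <= ralpha i k * condp mu (upd x z) y.
Proof.
move=> ik mx mxz; have a1 := ralpha_ge1 ik.
have := c0 x y; rewrite le_eqVlt => /orP[/eqP <-|cy].
  by rewrite mulr_ge0 ?c0// (le_trans ler01).
have h : (phi mu x z y <= alpha mu i k)%E.
  by apply: ereal_sup_ubound; exists x, z, y; split => //; split; rewrite ?marg_gt0E//; left.
have af : alpha mu i k \is a fin_num by rewrite alpha_fin// eq_sym.
(* A vanishing denominator would make [phi] equal to +oo, against the finiteness of [alpha i k]. *)
have := c0 (upd x z) y; rewrite le_eqVlt => /orP[/eqP e|cz].
  move: h; rewrite /phi -e inver eqxx gt0_muley ?lte_fin// leye_eq => /eqP h.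
  by move: af; rewrite h.
by move: h; rewrite phiE// -(fineK af) lee_fin ler_pdivrMr.
Qed.

Lemma condp_osc_rdelta i k x (z : Omega i) (y w : Omega k) : i != k ->
  0 < marg mu k x -> 0 < marg mu k (upd x z) ->
  0 < condp mu (upd x z) y -> 0 < condp mu (upd x z) w ->
  `|condp mu x y / condp mu (upd x z) y - condp mu x w / condp mu (upd x z) w| <= rdelta i k.
Proof.
move=> ik mx mxz cy cw.
have df : delta mu i k \is a fin_num by rewrite delta_fin// eq_sym.
rewrite -lee_fin fineK//; apply: ereal_sup_ubound; exists x, z, y, w.
by split; [split; rewrite ?marg_gt0E//; right|split; rewrite ?marg_gt0E//; right|rewrite !phiE].
Qed.

Lemma coef_le i :
  \sum_(k < N | k != i) (ralpha i k * ralpha k i - 1) +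
  4^-1 * (\sum_(k < N | k != i) (rdelta k i + rdelta i k) * (ralpha i k * ralpha k i)) <=
  1 - (1 - fine (gamma mu) - fine (kappa mu)).
Proof.
have e (u v : R) : 1 - (1 - u - v) = u + v by ring.
rewrite e; apply: lerD; rewrite -lee_fin fineK ?gamma_fin ?kappa_fin//.
  apply: le_trans (gterm_le i); rewrite -sumEFin; apply: lee_sum => k ki.
  have ik : i != k by rewrite eq_sym.
  rewrite -(fineK (alpha_fin ki)) -(fineK (alpha_fin ik)) -EFinM -EFinB.
  by rewrite lee_fin ler_norm.
apply: le_trans (kterm_le i); rewrite EFinM; apply: lee_wpmul2l; first by rewrite lee_fin.
rewrite -sumEFin; apply: lee_sum => k ki.
have ik : i != k by rewrite eq_sym.
rewrite -(fineK (alpha_fin ki)) -(fineK (alpha_fin ik)).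
by rewrite -(fineK (delta_fin ki)) -(fineK (delta_fin ik)) -EFinD -!EFinM.
Qed.

Lemma gap_gt0 : 0 < 1 - fine (gamma mu) - fine (kappa mu).
Proof.
have := gamma_kappa; rewrite -(fineK gamma_fin) -(fineK kappa_fin) -EFinD lte_fin; lra.
Qed.

End Coefficients.

(** * Approximate tensorization *)

Section EntropyGap.
Context {R : realType} {N : nat} {Omega : 'I_N -> pointedType}.
Variable mu : probability (config Omega) R.
Hypothesis countable_Omega : forall k, countable [set: Omega k].
Hypothesis gamma_kappa : (gamma mu + kappa mu < 1)%E.
Local Notation m := (pmass mu).
Local Notation P := (condE mu).
Local Notation c := (1 - fine (gamma mu) - fine (kappa mu)).
Local Notation gap := (entropy_gap mu c).
Implicit Types (x : config Omega) (f g : config Omega -> R) (i k : 'I_N).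

Let wm := weight_pmass mu countable_Omega.
Let c_gt0 : 0 < c. Proof. exact: gap_gt0. Qed.

Lemma norm_xlnx_le (v M : R) : 0 <= v <= M -> `|xlnx v| <= 1 + M ^+ 2.
Proof.
move=> /andP[v0 vM]; have M2 : 0 <= M ^+ 2 := sqr_ge0 M.
move: v0; rewrite le_eqVlt => /orP[/eqP <-|v0].
  by rewrite /xlnx mul0r normr0; lra.
have h1 := mul_lnB_le ltr01 v0; have h2 := ler_wpM2l (ltW v0) (ln_le_sub1 v0).
have h3 : v ^+ 2 <= M ^+ 2 by rewrite ler_sqr ?nnegrE ?(ltW v0)// (le_trans (ltW v0)).
rewrite ln1 in h1; rewrite /xlnx ler_norml; apply/andP; split; first by lra.
by move: h2; rewrite mulrBr -expr2; lra.
Qed.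

Lemma bounded_on_xlnx g M : (forall x, 0 < m x -> 0 <= g x <= M) ->
  bounded_on m (fun x => xlnx (g x)).
Proof. by move=> gb; exists (1 + M ^+ 2) => x /gb; exact: norm_xlnx_le. Qed.

Lemma cvg_xlnx_mean (g_ : nat -> config Omega -> R) g M :
  (forall n x, 0 < m x -> 0 <= g_ n x <= M) ->
  (forall x, 0 < m x -> g_ n x @[n --> \oo] --> g x) ->
  xlnx_mean mu (g_ n) @[n --> \oo] --> xlnx_mean mu g.
Proof.
move=> gM gg; apply: (cvg_wsum countable_Omega (C := 1 + M ^+ 2)).
  by move=> n x mx; apply: norm_xlnx_le; exact: gM.
move=> x mx; apply: cvg_xlnx; last exact: gg.
by move=> n; have /andP[] := gM n x mx.
Qed.

Lemma EntE g M : (forall x, 0 < m x -> 0 <= g x <= M) ->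
  Ent mu g = xlnx_mean mu g - xlnx (wsum m g).
Proof.
move=> gb; rewrite /Ent !Rintegral_config//; first exact: bounded_on_itv gb.
exact: bounded_on_xlnx gb.
Qed.

(** Stationarity replaces the mean of [P k (g ln g)] by that of [g ln g]. This is why [entropy_gap]
    can be written with [xlnx_mean] alone. *)
Lemma Rintegral_condEnt g M k : (forall x, 0 < m x -> 0 <= g x <= M) ->
  \int[mu]_x condEnt mu k g x = xlnx_mean mu g - xlnx_mean mu (P k g).
Proof.
move=> gb; have b1 := bounded_on_xlnx gb.
have Pb x : 0 < m x -> 0 <= P k g x <= M.
  by move=> mx; apply: condE_itv => //; exact: marg_gt0.
have b2 := bounded_on_xlnx Pb; have b3 := bounded_condE countable_Omega k b1.
have b4 : bounded_on m (fun x => P k (fun z => xlnx (g z)) x - xlnx (P k g x)) by bounded.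
have -> : condEnt mu k g = (fun x => P k (fun z => xlnx (g z)) x - xlnx (P k g x)) by [].
by rewrite Rintegral_config// wsumB// wsum_condE.
Qed.

Section Flow.
Variables (f : config Omega -> R) (e M : R).
Hypothesis e0 : 0 < e.
Hypothesis fb : forall x, 0 < m x -> e <= f x <= M.

Let fM x : 0 < m x -> `|f x| <= M.
Proof.
move=> /fb /andP[h1 h2]; rewrite ger0_norm//.
exact: le_trans (ltW e0) h1.
Qed.

Lemma iter_euler_itv s n x : 0 <= s -> s * N%:R <= 1 -> 0 < m x ->
  e <= iter n (euler_step mu s) f x <= M.
Proof.
by move=> s0 sN; elim: n x => [|n ih] x mx; [exact: fb|exact: euler_itv].
Qed.

Lemma wsum_iter_euler s n : 0 <= s -> s * N%:R <= 1 ->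
  wsum m (iter n (euler_step mu s) f) = wsum m f.
Proof.
move=> s0 sN; elim: n => // n <-; rewrite iterS.
have bg := bounded_on_itv (fun x => @iter_euler_itv s n x s0 sN).
have bL := bounded_generator countable_Omega bg.
move: (iter n _ f) bg bL => g bg bL.
rewrite /euler_step wsumD//; last by bounded.
by rewrite (wsumZ s)// wsum_generator// mulr0 addr0.
Qed.

Lemma gap_iter_euler s n : 0 <= s -> s * N%:R <= 1 ->
  gap (iter n (euler_step mu s) f) <=
  gap f + n%:R * (s ^+ 2 * (N%:R * ((N%:R * (M - e)) ^+ 2 / e))).
Proof.
move=> s0 sN; elim: n => [|n ih]; first by rewrite mul0r addr0.
rewrite iterS -natr1 mulrDl mul1r addrA.
have gb x := @iter_euler_itv s n x s0 sN.
apply: (@le_trans _ _ (gap (iter n (euler_step mu s) f) +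
    s ^+ 2 * (N%:R * ((N%:R * (M - e)) ^+ 2 / e)))); last by rewrite lerD2r.
have a0 i k : i != k -> 0 <= ralpha mu i k.
  by move=> ik; apply: le_trans (ralpha_ge1 countable_Omega gamma_kappa ik).
exact: (entropy_gap_step countable_Omega a0
  (ralphaM_ge1 countable_Omega gamma_kappa)
  (fun i k _ => rdelta_ge0 mu countable_Omega i k)
  (condp_le_ralpha countable_Omega gamma_kappa)
  (condp_osc_rdelta countable_Omega gamma_kappa)
  (ltW c_gt0) (coef_le countable_Omega gamma_kappa) e0 gb s0 sN).
Qed.

(** Conditional entropies are nonnegative; without them only the term that ergodicity controls
    remains. *)
Lemma entropy_gap_ge g : (forall x, 0 < m x -> e <= g x <= M) ->
  - (c * (xlnx_mean mu g - xlnx (wsum m g))) <= gap g.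
Proof.
move=> gb; rewrite /entropy_gap -[leLHS]add0r lerD2r; apply: sumr_ge0 => k _.
by rewrite subr_ge0; exact: (xlnx_mean_condE_le countable_Omega e0 gb).
Qed.

(** With [n] steps of size [t / n], the total error is of order [1 / n]. The conditional entropies
    are discarded before the limit of the scheme is taken, so that only [Ent] has to converge, by
    dominated convergence. *)
Lemma Ent_heat_bath_ge (t : R) : 0 <= t -> - (c * Ent mu (heat_bath mu t f)) <= gap f.
Proof.
move=> t0; set B := N%:R * ((N%:R * (M - e)) ^+ 2 / e).
(* Starting from [n0] steps makes [s n * N <= 1], and hence positivity, hold for every [n]; a shift
   of the index does not affect limits. *)
pose n0 := Num.truncn (t * N%:R).
pose s n : R := t / (n + n0).+1%:R.
have s0 n : 0 <= s n by rewrite divr_ge0.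
have sN n : s n * N%:R <= 1.
  rewrite /s mulrAC ler_pdivrMr ?ltr0n// mul1r.
  apply: le_trans (ltW (truncnS_gt _)) _.
  by rewrite ler_nat ltnS leq_addl.
pose g n := iter (n + n0).+1 (euler_step mu (s n)) f.
have gb n x : 0 < m x -> e <= g n x <= M by exact: iter_euler_itv.
have gb0 n x : 0 < m x -> 0 <= g n x <= M.
  by move=> /(gb n) /andP[h1 ->]; rewrite (le_trans (ltW e0) h1).
have gf x : 0 < m x -> g n x @[n --> \oo] --> heat_bath mu t f x.
  move=> mx; have := cvg_iter_euler countable_Omega fM t0 mx.
  by rewrite -(cvg_shiftn n0).
have fb0 x : 0 < m x -> 0 <= heat_bath mu t f x <= M.
  move=> mx; have /(cvg_lim (@Rhausdorff R)) <- := gf x mx.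
  have cg : cvgn (fun n => g n x) by apply/cvg_ex; eexists; exact: gf.
  apply/andP; split.
    by apply: limr_ge => //; apply: nearW => n; have /andP[] := gb0 n x mx.
  by apply: limr_le => //; apply: nearW => n; have /andP[] := gb0 n x mx.
have wE : wsum m (heat_bath mu t f) = wsum m f.
  have h : wsum m (g n) @[n --> \oo] --> wsum m (heat_bath mu t f).
    apply: (cvg_wsum countable_Omega (C := M)) => // n x mx.
    by have /andP[h1 h2] := gb0 n x mx; rewrite ger0_norm.
  have gE : (fun n => wsum m (g n)) = (fun=> wsum m f).
    by apply/funext => n; rewrite wsum_iter_euler.
  rewrite gE in h.
  by have /(cvg_lim (@Rhausdorff R)) <- := h; rewrite lim_cst.
rewrite (EntE fb0) wE.
have cl : - (c * (xlnx_mean mu (g n) - xlnx (wsum m f))) @[n --> \oo] -->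
    - (c * (xlnx_mean mu (heat_bath mu t f) - xlnx (wsum m f))).
  apply: cvgN; apply: cvgM; first exact: cvg_cst.
  by apply: cvgB; [exact: (cvg_xlnx_mean gb0 gf)|exact: cvg_cst].
have cr : gap f + t ^+ 2 * B / (n + n0).+1%:R @[n --> \oo] --> gap f.
  rewrite -[X in _ --> X]addr0; apply: cvgD; first exact: cvg_cst.
  have := cvg_inv_cst (t ^+ 2 * B).
  by rewrite -(cvg_shiftn n0).
apply: (ler_cvg_to cl cr); apply: nearW => n.
rewrite -(wsum_iter_euler (n + n0).+1 (s0 n) (sN n)).
apply: le_trans (entropy_gap_ge (gb n)) _.
apply: le_trans (gap_iter_euler (n + n0).+1 (s0 n) (sN n)) _.
rewrite lerD2l -/B /s le_eqVlt; apply/orP; left; apply/eqP.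
have p0 : ((n + n0).+1%:R : R) != 0 by rewrite pnatr_eq0.
by move: ((n + n0).+1%:R : R) p0 => p p0; field.
Qed.

Lemma entropy_gap_ge0 :
  Ent mu (heat_bath mu t f) @[t --> +oo] --> 0 -> 0 <= gap f.
Proof.
move=> erg; have cl : - (c * Ent mu (heat_bath mu t f)) @[t --> +oo] --> 0.
  rewrite -[X in _ --> X]oppr0 -(mulr0 c); apply: cvgN; apply: cvgM => //.
  exact: cvg_cst.
apply: (ler_cvg_to cl (cvg_cst (gap f))).
by near=> t; apply: Ent_heat_bath_ge; near: t; exact: nbhs_pinfty_ge.
Unshelve. all: by end_near. Qed.

End Flow.

(** Adding a constant commutes with [P k] and with the mean, so each term converges by continuity of
    [xlnx] up to 0. This frees the result from the lower bound [e] that the flow estimates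
    require. *)
Lemma cvg_entropy_gap_shift f M : (forall x, 0 < m x -> 0 <= f x <= M) ->
  gap (fun x => f x + n.+1%:R^-1) @[n --> \oo] --> gap f.
Proof.
move=> fb; have ie (n : nat) : 0 <= (n.+1%:R : R)^-1 <= 1.
  by rewrite invr_ge0 ler0n /= invf_le1 ?ltr0n// ler1n.
have bf := bounded_on_itv fb.
have M1 (u : R) n : 0 <= u <= M -> 0 <= u + n.+1%:R^-1 <= M + 1.
  by move=> /andP[u0 uM]; have /andP[i0 i1] := ie n; rewrite addr_ge0//= lerD.
have cs (u : R) : u + n.+1%:R^-1 @[n --> \oo] --> u.
  by rewrite -[X in _ --> X]addr0; apply: cvgD; [exact: cvg_cst|exact: cvg_harmonic].
have cf : xlnx_mean mu (fun x => f x + n.+1%:R^-1) @[n --> \oo] --> xlnx_mean mu f.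
  by apply: (@cvg_xlnx_mean _ _ (M + 1)) => [n x /fb|x _]; [exact: M1|exact: cs].
have Pb k x : 0 < m x -> 0 <= P k f x <= M.
  by move=> mx; apply: condE_itv => //; exact: marg_gt0.
have PE k n x : 0 < m x -> P k (fun z => f z + n.+1%:R^-1) x = P k f x + n.+1%:R^-1.
  move=> mx; rewrite condED//; last exact: bounded_on_cst.
  by rewrite [X in _ + X]wsum_condp_cst.
have cP k : xlnx_mean mu (P k (fun x => f x + n.+1%:R^-1)) @[n --> \oo] --> xlnx_mean mu (P k f).
  apply: (@cvg_xlnx_mean _ _ (M + 1)) => [n x mx|x mx].
    by rewrite PE//; apply: M1; exact: Pb.
  have -> : (fun n => P k (fun z => f z + n.+1%:R^-1) x) = (fun n => P k f x + n.+1%:R^-1).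
    by apply/funext => n; exact: PE.
  exact: cs.
have cw : xlnx (wsum m (fun x => f x + n.+1%:R^-1)) @[n --> \oo] --> xlnx (wsum m f).
  have wE n : wsum m (fun x => f x + n.+1%:R^-1) = wsum m f + n.+1%:R^-1.
    rewrite wsumD//; last exact: bounded_on_cst.
    by rewrite wsum_cst// rsum_pmass// mulr1.
  under eq_fun do rewrite wE.
  apply: cvg_xlnx; last exact: cs.
  move=> n; have /andP[i0 _] := ie n; rewrite addr_ge0//.
  by apply: wsum_ge0 => [x|x /fb /andP[]//]; exact: pmass_ge0.
rewrite /entropy_gap; apply: cvgB; last first.
  by apply: cvgM; [exact: cvg_cst|exact: cvgB].
by apply: cvg_big => [|k _]; [exact: add_continuous|exact: cvgB].
Qed.

End EntropyGap.

Theorem theorem2p1 (R : realType) (N : nat) (Omega : 'I_N -> pointedType)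
    (countable_Omega : forall k, countable [set: Omega k])
    (mu : probability (config Omega) R)
    (ergodic : forall f : config Omega -> R,
       measurable_fun setT f -> bounded_fun f -> (forall x, 0 <= f x) ->
       Ent mu (heat_bath mu t f) @[t --> +oo] --> 0)
    (gamma_kappa : (gamma mu + kappa mu < 1)%E)
    (f : config Omega -> R)
    (mf : measurable_fun setT f) (bf : bounded_fun f)
    (f0 : forall x, 0 <= f x) :
  Ent mu f <=
    (1 - fine (gamma mu) - fine (kappa mu))^-1 *
    \sum_(k < N) \int[mu]_x condEnt mu k f x.
Proof.
have [M fM] : exists M, forall x, f x <= M.
  have [B [_ hB]] := bf; exists (B + 1) => x.
  by apply: le_trans (ler_norm _) _; apply: (hB (B + 1)) => //; rewrite ltrDl.
have fb x : 0 < pmass mu x -> 0 <= f x <= M by rewrite f0 fM.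
have c0 := gap_gt0 gamma_kappa.
(* Ergodicity is applied to the shifts [f + 1 / (n + 1)], which are bounded away from 0, and the
   sign passes to [f] in the limit. *)
have h : 0 <= entropy_gap mu (1 - fine (gamma mu) - fine (kappa mu)) f.
  have cg := cvg_entropy_gap_shift countable_Omega fb.
  have /(cvg_lim (@Rhausdorff R)) <- := cg.
  apply: limr_ge; first by apply/cvg_ex; eexists; exact: cg.
  apply: nearW => n; have i0 : 0 < (n.+1%:R : R)^-1 by rewrite invr_gt0 ltr0n.
  apply: (entropy_gap_ge0 countable_Omega gamma_kappa (M := M + n.+1%:R^-1) i0).
    by move=> x _; rewrite lerDr f0 lerD2r fM.
  apply: ergodic.
  - by move=> _ A _.
  - exists (M + n.+1%:R^-1); split; first exact: num_real.
    move=> y yM x _; apply: le_trans (ltW yM); rewrite ger0_norm; first by rewrite lerD2r fM.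
    by rewrite addr_ge0// ltW.
  - by move=> x; rewrite addr_ge0// ltW.
rewrite ler_pdivlMl// (EntE countable_Omega fb) -subr_ge0.
by under eq_bigr do rewrite (Rintegral_condEnt countable_Omega _ fb).
Qed.
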